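(* Fix $d\in\{3,5\}$. Let $u\in L^2(\mathbb T^2)$ be real with $\mathbb P_{x\ne0}u=u$, and suppose that $$(-1)^{(d+1)/2}\partial_x^du-\partial_x^{-1}\partial_y^2u+\partial_x(u^2)=0\quad\text{in }\mathcal D'(\mathbb T^2),$$ where $u^2$ is the ordinary $L^1$ product. Then $u\in C^\infty(\mathbb T^2)$.
   Context: $\mathbb T^2=(\mathbb R/\mathbb Z)_x\times(\mathbb R/\mathbb Z)_y$ with normalized Haar measure and $\widehat f(n,m)=\int_{\mathbb T^2}f(x,y)e^{-2\pi i(nx+my)}\,dx\,dy$. $\mathbb P_{x\ne0}$ is the Fourier projection onto modes $(n,m)$ with $n\neq0$, so $\mathbb P_{x\ne0}u=u$ means $\widehat u(0,m)=0$ for all $m\in\mathbb Z$. The operator $\partial_x^{-1}$ is defined by $\widehat{\partial_x^{-1}f}(n,m)=(2\pi i n)^{-1}\widehat f(n,m)$ for $n\ne0$ and $0$ for $n=0$. *)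

(* Defs.v *)
From HB Require Import structures.
From mathcomp Require Import all_boot all_order all_algebra.
From mathcomp Require Import all_classical all_reals all_analysis.
From mathcomp Require Import complex.

Set Implicit Arguments.
Unset Strict Implicit.
Unset Printing Implicit Defensive.

Import Order.TTheory GRing.Theory Num.Theory.
Import numFieldNormedType.Exports.

Local Open Scope classical_set_scope.
Local Open Scope complex_scope.
Local Open Scope ring_scope.

(* Functions on the torus (R/Z)^2 are represented by functions on R * R that
   are 1-periodic in each variable; normalized Haar measure is Lebesgue measure
   on the fundamental domain [0,1[ x [0,1[. *)

Section Torus.
Context {R : realType}.

Definition periodic2 (T : Type) (f : R * R -> T) : Prop :=
  forall x y, f (x + 1, y) = f (x, y) /\ f (x, y + 1) = f (x, y).

Definition cell : set (R * R) := `[0, 1[%classic `*` `[0, 1[%classic.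

Definition leb2 :
    {measure set (measurableTypeR R * measurableTypeR R) -> \bar R} :=
  (@lebesgue_measure R \x @lebesgue_measure R)%E.

(* A function u : R * R -> R represents an element of real L^2(T^2). *)
Definition L2torus (u : R * R -> R) : Prop :=
  [/\ periodic2 u,
      measurable_fun (setT : set (measurableTypeR R * measurableTypeR R)) u &
      leb2.-integrable cell (fun p => (u p ^+ 2)%:E)].

Definition tint (f : R * R -> R[i]) : R[i] :=
  (\int[leb2]_(p in cell) complex.Re (f p)) +i*
  (\int[leb2]_(p in cell) complex.Im (f p)).

(* echar n m (x, y) = e^{2 pi i (n x + m y)} *)
Definition echar (n m : int) (p : R * R) : R[i] :=
  let t := 2 * pi * (n%:~R * p.1 + m%:~R * p.2) in cos t +i* sin t.

Definition fcoef (f : R * R -> R[i]) (n m : int) : R[i] :=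
  tint (fun p => f p * echar (- n) (- m) p).

Definition e_x : R * R := (1, 0).
Definition e_y : R * R := (0, 1).

Fixpoint Ck (k : nat) (f : R * R -> R) : Prop :=
  continuous f /\
  if k is k'.+1 then
    [/\ forall p, derivable f p e_x /\ derivable f p e_y,
        Ck k' (fun p => 'D_e_x f p) & Ck k' (fun p => 'D_e_y f p)]
  else True.

Definition smooth (f : R * R -> R) : Prop := forall k, Ck k f.

Definition test_fun (phi : R * R -> R[i]) : Prop :=
  [/\ periodic2 phi, smooth (fun p => complex.Re (phi p)) &
      smooth (fun p => complex.Im (phi p))].

Definition cderive (v : R * R) (phi : R * R -> R[i]) (p : R * R) : R[i] :=
  ('D_v (fun q => complex.Re (phi q)) p) +i*
  ('D_v (fun q => complex.Im (phi q)) p).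

(* A functional is only meaningful through its values on test functions; all
   the notions below quantify over test functions only. *)
Definition functional := (R * R -> R[i]) -> R[i].

(* Elements of D'(T^2): linear functionals on test functions that are
   continuous for the seminorms sup |dx^a dy^b phi|. *)
Definition is_distribution (T : functional) : Prop :=
  (forall (c : R[i]) phi psi, test_fun phi -> test_fun psi ->
     T (fun p => c * phi p + psi p) = c * T phi + T psi) /\
  (exists (N : nat) (K : R), forall phi (B : R), test_fun phi ->
     (forall a b, (a + b <= N)%N -> forall p,
        `|iter a (cderive e_x) (iter b (cderive e_y) phi) p| <= B%:C) ->
     `|T phi| <= (K * B)%:C).

(* The distribution defined by an integrable function. *)
Definition distr_of (f : R * R -> R[i]) : functional :=
  fun phi => tint (fun p => f p * phi p).

Definition distr_derive (v : R * R) (T : functional) : functional :=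
  fun phi => - T (cderive v phi).

Notation dx := (distr_derive e_x).
Notation dy := (distr_derive e_y).

(* Agrees with fcoef on distributions of the form distr_of f. *)
Definition dcoef (T : functional) (n m : int) : R[i] :=
  T (echar (- n) (- m)).

(* S = dx^{-1} T in D'(T^2); S is unique since a distribution on the torus is
   determined by its Fourier coefficients. *)
Definition is_dxinv (T S : functional) : Prop :=
  is_distribution S /\
  forall n m : int, dcoef S n m =
    if n == 0 then 0 else ((2 * pi * n%:~R)*i)^-1 * dcoef T n m.

Definition distr_eq (T S : functional) : Prop :=
  forall phi, test_fun phi -> T phi = S phi.

(* (-1)^{(d+1)/2} dx^d u - dx^{-1} dy^2 u + dx (u^2) = 0 in D'(T^2) *)
Definition weak_solution (d : nat) (u : R * R -> R) : Prop :=
  let U := distr_of (fun p => (u p)%:C) in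
  let U2 := distr_of (fun p => (u p ^+ 2)%:C) in
  exists2 S : functional, is_dxinv (dy (dy U)) S &
    distr_eq
      (fun phi => (-1) ^+ (d.+1)./2 * iter d dx U phi - S phi + dx U2 phi)
      (fun=> 0).

(* The L^2 class of u has a smooth representative on the torus. *)
Definition smooth_on_torus (u : R * R -> R) : Prop :=
  exists g : R * R -> R,
    [/\ periodic2 g, smooth g & {ae leb2, forall p, cell p -> u p = g p}].

End Torus.

(* Main.v *)
Require Import Defs.
From mathcomp Require Import all_boot all_order all_algebra.
From mathcomp Require Import all_classical all_reals all_analysis.
From mathcomp Require Import complex measurable_realfun.
From mathcomp Require Import ring lra zify.

(** The Fourier coefficients a(n, m) of u and b(n, m) of u^2 satisfy
        ((2 pi)^(d - 1) n^(d + 1) + m^2) a(n, m) = n^2 b(n, m),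
    as one sees by testing the equation on characters, and a(0, m) = 0. For both
    values of d the sign is such that the symbol on the left does not vanish for
    n <> 0; it is at least n^4 + m^2, so that |a| <= 3 W^(-1) |b| with the
    parabolic weight W = 1 + n^2 + |m| ([weak_solution_elliptic], [elliptic_gain]).

    The gain of one power of W beats the loss in forming u^2 from a square-integrable
    u. Let V be the eighth root of W. If the sum of |a|^2 V^(2 j) is finite, then the
    convolution inequality, which rests on V (p + q) <= 2 max (V p) (V q), bounds
    |b| V^j ([conv_bound]); hence |a| V^(j + 8) is bounded, and |a|^2 V^(2 j + 2) is at
    most a constant times V^(-14) = W^(-7/4). This is summable, as 7/4 exceeds the
    homogeneous dimension 3/2 of the lattice ([sum_bounded_weight]). Starting from
    Bessel's inequality, induction on j ([bootstrap]) shows that a decreases faster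
    than any power.

    That b is the convolution of a with itself requires the completeness of the
    trigonometric system in square mean ([fourier_sum_cvg]), and so does the
    identification of u with the sum of its Fourier series. Partial Fourier sums are
    best approximations, so trigonometric polynomials only have to be dense. Measurable
    sets with approximable indicator form a sigma-algebra, and it contains the sets
    x < a and y < a because the polynomials (1 - g^n)^(2^n) in a suitable trigonometric
    polynomial g converge almost everywhere to their indicator; simple functions do
    the rest.

    Finally a series with rapidly decreasing coefficients can be differentiated term by
    term any number of times ([trig_series_smooth]), and its sum equals u almost
    everywhere ([ae_eq_trig_series]).

    All computations use real Fourier coefficients with respect to the functions
    [cosk k] and [sink k]; complex numbers appear only when the equation is tested. *)

Set Implicit Arguments.
Unset Strict Implicit.
Unset Printing Implicit Defensive.

Import Order.TTheory GRing.Theory Num.Theory.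
Import numFieldNormedType.Exports.

Local Open Scope classical_set_scope.
Local Open Scope complex_scope.
Local Open Scope ring_scope.

(** * Integration over the fundamental cell *)

Section Integration.
Context {R : realType}.
Implicit Types f g h : R * R -> R.

Let sqr_normE (x : R) : `|x| ^+ 2 = x ^+ 2. Proof. by rewrite real_normK// num_real. Qed.

(** Measurability of a function on the whole plane for the product of the two
    Borel structures. *)
Definition meas2 f :=
  measurable_fun (setT : set (measurableTypeR R * measurableTypeR R)) f.

(** The integral over the fundamental cell, i.e. the mean over the torus. It is
    a total function: the value is meaningful only when [L1 f] holds. *)
Definition tmean f : R := \int[@leb2 R]_(p in @cell R) f p.

(** Measurable on the plane and integrable on the cell. Periodicity is not part
    of the definition: only values on the cell matter for integrals. *)
Definition L1 f := meas2 f /\ (@leb2 R).-integrable (@cell R) (EFin \o f).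

(** Measurable on the plane and square-integrable on the cell. *)
Definition L2 f := meas2 f /\ (@leb2 R).-integrable (@cell R) (fun p => (f p ^+ 2)%:E).

Lemma measurable_cell : measurable (@cell R : set (measurableTypeR R * measurableTypeR R)).
Proof. by apply: measurableX; exact: measurable_itv. Qed.
Hint Resolve measurable_cell : core.

Lemma leb2_cell : @leb2 R (@cell R) = 1%E.
Proof.
rewrite /leb2 /= product_measure1E; [|exact: measurable_itv|exact: measurable_itv].
by have /= -> := @lebesgue_measure_itv R `[0, 1[; rewrite lte_fin ltr01 sube0 mule1.
Qed.

Lemma meas2S f : meas2 f -> measurable_fun (@cell R :
  set (measurableTypeR R * measurableTypeR R)) f.
Proof. by move=> mf; apply: measurable_funS mf. Qed.

Lemma L1_dom f g : meas2 f -> L1 g -> (forall p, cell p -> `|f p| <= g p) -> L1 f.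
Proof.
move=> mf [mg ig] fg; split=> //.
apply: (le_integrable _ _ _ ig) => //.
  by apply/measurable_EFinP; exact: meas2S.
move=> p cp /=; rewrite lee_fin (le_trans (fg _ cp))//.
by rewrite ger0_norm// (le_trans _ (fg _ cp)).
Qed.

Lemma L1_cst (c : R) : L1 (fun=> c).
Proof.
split; first exact: measurable_cst.
apply: measurable_bounded_integrable => //; last first.
- exists `|c|; split; first by rewrite realE normr_ge0.
  by move=> y cy p _ /=; exact: ltW.
- by rewrite leb2_cell ltry.
Qed.

Lemma L1D f g : L1 f -> L1 g -> L1 (fun p => f p + g p).
Proof.
move=> [mf if_] [mg ig]; split; first exact: measurable_funD.
have := integrableD measurable_cell if_ ig.
by apply: eq_integrable.
Qed.

Lemma L1Z c f : L1 f -> L1 (fun p => c * f p).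
Proof.
move=> [mf if_]; split; first by apply: measurable_funM => //; exact: measurable_cst.
have := integrableZl measurable_cell c if_.
by apply: eq_integrable.
Qed.

Lemma L1N f : L1 f -> L1 (fun p => - f p).
Proof.
by move=> /(L1Z (-1)); congr L1; apply/funext => p; rewrite mulN1r.
Qed.

Lemma L1B f g : L1 f -> L1 g -> L1 (fun p => f p - g p).
Proof. by move=> f1 /L1N; exact: L1D. Qed.

Lemma L1_norm f : L1 f -> L1 (fun p => `|f p|).
Proof.
move=> [mf if_]; split; first exact: measurableT_comp.
exact: integrable_norm.
Qed.

Lemma L2_sqr f : L2 f -> L1 (fun p => f p ^+ 2).
Proof. by move=> [mf if_]; split=> //; exact: measurable_funX. Qed.

Lemma sqr_L2 f : meas2 f -> L1 (fun p => f p ^+ 2) -> L2 f.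
Proof. by move=> mf [_ ?]. Qed.

Lemma L2_dom f g : meas2 f -> L2 g -> (forall p, cell p -> `|f p| <= `|g p|) -> L2 f.
Proof.
move=> mf g2 fg; apply: sqr_L2 => //.
apply: L1_dom (L2_sqr g2) _; first exact: measurable_funX.
move=> p cp; rewrite normrX -[leRHS]sqr_normE.
by rewrite lerXn2r ?nnegrE ?fg.
Qed.

Lemma L2_bnd c f : meas2 f -> (forall p, cell p -> `|f p| <= c) -> L2 f.
Proof.
move=> mf fc; apply: (@L2_dom _ (fun=> c)) => //.
  apply: sqr_L2; first exact: measurable_cst.
  exact: L1_cst.
by move=> p cp; rewrite (le_trans (fc _ cp))// ler_norm.
Qed.

Lemma L2M f g : L2 f -> L2 g -> L1 (fun p => f p * g p).
Proof.
move=> f2 g2; have h := L1D (L2_sqr f2) (L2_sqr g2).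
apply: (L1_dom _ h); first by apply: measurable_funM; [case: f2|case: g2].
move=> p _; rewrite normrM -(sqr_normE (f p)) -(sqr_normE (g p)).
by nra.
Qed.

Lemma L2D f g : L2 f -> L2 g -> L2 (fun p => f p + g p).
Proof.
move=> f2 g2; apply: sqr_L2.
  by apply: measurable_funD; [case: f2|case: g2].
have := L1D (L1D (L2_sqr f2) (L2_sqr g2)) (L1Z 2 (L2M f2 g2)).
by congr L1; apply/funext => p; ring.
Qed.

Lemma L2Z c f : L2 f -> L2 (fun p => c * f p).
Proof.
move=> f2; apply: sqr_L2.
  by apply: measurable_funM; [exact: measurable_cst|case: f2].
by have := L1Z (c ^+ 2) (L2_sqr f2); congr L1; apply/funext => p; ring.
Qed.

Lemma L2B f g : L2 f -> L2 g -> L2 (fun p => f p - g p).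
Proof.
move=> f2 /(L2Z (-1)) /(L2D f2); congr L2; apply/funext => p.
by rewrite mulN1r.
Qed.

Lemma L2_bndM c f g : L2 f -> meas2 g -> (forall p, cell p -> `|g p| <= c) ->
  L2 (fun p => f p * g p).
Proof.
move=> f2 mg gc; apply: (L2_dom _ (L2Z c f2)).
  by apply: measurable_funM => //; case: f2.
move=> p cp; rewrite !normrM mulrC ler_wpM2r//.
by rewrite (le_trans (gc _ cp))// ler_norm.
Qed.

Lemma L2_L1 f : L2 f -> L1 f.
Proof.
move=> f2; have c2 : L2 (fun=> 1 : R).
  by apply: (@L2_bnd 1) => [|p _]; [exact: measurable_cst|rewrite normr1].
by have := L2M f2 c2; congr L1; apply/funext => p; rewrite mulr1.
Qed.

Lemma tmeanD f g : L1 f -> L1 g -> tmean (fun p => f p + g p) = tmean f + tmean g.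
Proof. by move=> [_ ?] [_ ?]; exact: RintegralD. Qed.

Lemma tmeanZ c f : L1 f -> tmean (fun p => c * f p) = c * tmean f.
Proof. by move=> [_ ?]; exact: RintegralZl. Qed.

Lemma tmeanB f g : L1 f -> L1 g -> tmean (fun p => f p - g p) = tmean f - tmean g.
Proof. by move=> [_ ?] [_ ?]; exact: RintegralB. Qed.

Lemma tmean_ge0 f : (forall p, 0 <= f p) -> 0 <= tmean f.
Proof. by move=> f0; apply: Rintegral_ge0. Qed.

Lemma le_tmean f g : L1 f -> L1 g -> (forall p, cell p -> f p <= g p) -> tmean f <= tmean g.
Proof. by move=> [_ ?] [_ ?] ?; exact: le_Rintegral. Qed.

Lemma eq_tmean f g : (forall p, cell p -> f p = g p) -> tmean f = tmean g.
Proof. by move=> fg; apply: eq_Rintegral => p; rewrite inE; exact: fg. Qed.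

Lemma tmean_cst c : tmean (fun=> c) = c.
Proof. by rewrite /tmean Rintegral_cst// leb2_cell mulr1. Qed.

Lemma norm_tmean f : L1 f -> `|tmean f| <= tmean (fun p => `|f p|).
Proof. by move=> [_ ?]; exact: le_normr_Rintegral. Qed.

Lemma L1_sum (T : Type) (s : seq T) (F : T -> R * R -> R) :
  (forall t, L1 (F t)) -> L1 (fun p => \sum_(t <- s) F t p).
Proof.
move=> F1; elim: s => [|t s ih].
  by rewrite (_ : (fun _ => _) = cst 0); [exact: L1_cst|apply/funext => p; rewrite big_nil].
have := L1D (F1 t) ih; congr L1; apply/funext => p; by rewrite big_cons.
Qed.

Lemma tmean_sum (T : Type) (s : seq T) (F : T -> R * R -> R) :
  (forall t, L1 (F t)) -> tmean (fun p => \sum_(t <- s) F t p) = \sum_(t <- s) tmean (F t).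
Proof.
move=> F1; elim: s => [|t s ih].
  by rewrite big_nil -[RHS](tmean_cst 0); apply: eq_tmean => p _; rewrite big_nil.
rewrite big_cons -ih -tmeanD//; last exact: L1_sum.
by apply: eq_tmean => p _; rewrite big_cons.
Qed.

Lemma L2_sum (T : Type) (s : seq T) (F : T -> R * R -> R) :
  (forall t, L2 (F t)) -> L2 (fun p => \sum_(t <- s) F t p).
Proof.
move=> F1; elim: s => [|t s ih].
  rewrite (_ : (fun _ => _) = cst 0).
    by apply: (@L2_bnd 0) => [|p _]; [exact: measurable_cst|rewrite normr0].
  by apply/funext => p; rewrite big_nil.
have := L2D (F1 t) ih; congr L2; apply/funext => p; by rewrite big_cons.
Qed.

(** A weighted form of the Cauchy-Schwarz inequality; the free parameter makes
    the first factor as negligible as needed. *)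
Lemma tmean_young (l : R) f g : 0 < l -> L2 f -> L2 g ->
  `|tmean (fun p => f p * g p)| <= l * tmean (fun p => f p ^+ 2) + l^-1 * tmean (fun p => g p ^+ 2).
Proof.
move=> l0 f2 g2; apply: (le_trans (norm_tmean (L2M f2 g2))).
have f1 := L2_sqr f2; have g1 := L2_sqr g2.
rewrite -!tmeanZ// -tmeanD//; [|exact: L1Z|exact: L1Z].
apply: le_tmean; [exact/L1_norm/L2M|by apply: L1D; exact: L1Z|].
move=> p _; rewrite normrM -(sqr_normE (f p)) -(sqr_normE (g p)).
set a := `|f p|; set b := `|g p|.
have a0 : 0 <= a by exact: normr_ge0.
have b0 : 0 <= b by exact: normr_ge0.
rewrite -(ler_pM2l l0) mulrDr !mulrA divff ?gt_eqF// mul1r.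
(* the square says that l a b <= l^2 a^2 + b^2 / 4 *)
have : 0 <= (l * a - b / 2) ^+ 2 by exact: sqr_ge0.
nra.
Qed.

(** Dominated convergence in the mean square. *)
Lemma L2_dominated (F : nat -> R * R -> R) f h : (forall n, meas2 (F n)) -> meas2 f ->
  L2 h -> (forall n p, cell p -> `|F n p| <= h p) ->
  (forall p, cell p -> `|f p| <= h p) ->
  {ae @leb2 R, forall p, cell p -> F ^~ p @ \oo --> f p} ->
  (fun n => tmean (fun p => (F n p - f p) ^+ 2)) @ \oo --> (0 : R).
Proof.
move=> mF mf h2 Fh fh Ff.
(* both functions are at most h, so the squared difference is at most 4 h^2 *)
have h1 : L1 (fun p => 4 * h p ^+ 2) by apply: L1Z; exact: L2_sqr.
have mFf n : meas2 (fun p => (F n p - f p) ^+ 2).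
  by apply: measurable_funX; apply: measurable_funB; [exact: mF|exact: mf].
have [|||||] := @dominated_convergence _ _ _ (@leb2 R) (@cell R) measurable_cell
  (fun n p => ((F n p - f p) ^+ 2)%:E) (cst 0%E) (fun p => (4 * h p ^+ 2)%:E).
- by move=> n; apply/measurable_EFinP; exact: meas2S.
- exact: measurable_cst.
- case: Ff => N [mN N0 FN]; exists N; split=> //.
  apply: subset_trans FN; apply: subsetC => p Fp cp.
  apply: cvg_EFin; first by apply: nearW.
  rewrite (_ : _ \o _ = (fun n => (F n p - f p) * (F n p - f p))); last exact/funext.
  have -> : (0 : R) = (f p - f p) * (f p - f p) by rewrite subrr mulr0.
  by apply: cvgM; (apply: cvgB; [exact: Fp|exact: cvg_cst]).
- by case: h1.
- apply: aeW => p n cp; rewrite gee0_abs ?lee_fin ?sqr_ge0//.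
  have := Fh n _ cp; have := fh _ cp; rewrite !ler_norml => /andP[? ?] /andP[? ?].
  by nra.
move=> _ _; rewrite integral0 => /fine_cvg.
by [].
Qed.

End Integration.

(** * The real trigonometric system *)

Section Trig.
Context {R : realType}.
Implicit Types (p : R * R) (k l : int * int).

Lemma sin_2piz (n : int) : sin (2 * pi * n%:~R) = 0 :> R.
Proof.
have h2 (m : nat) : sin (2 * pi * m%:R) = 0 :> R.
  have := @periodicn R R (@sin R) (pi *+ 2) (@sinD2pi R) m 0.
  by move=> h; rewrite -[RHS]sin0 -h; congr sin; rewrite add0r -mulrnA -(mulr_natr pi) natrM; ring.
case: n => m; first by rewrite -pmulrn h2.
by rewrite NegzE mulrNz mulrN sinN h2 oppr0.
Qed.

Lemma cos_2piz (n : int) : cos (2 * pi * n%:~R) = 1 :> R.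
Proof.
have h2 (m : nat) : cos (2 * pi * m%:R) = 1 :> R.
  have := @periodicn R R (@cos R) (pi *+ 2) (@cosD2pi R) m 0.
  by move=> h; rewrite -[RHS]cos0 -h; congr cos; rewrite add0r -mulrnA -(mulr_natr pi) natrM; ring.
case: n => m; first by rewrite -pmulrn h2.
by rewrite NegzE mulrNz mulrN cosN h2.
Qed.

(** The mean over one period of a function of one variable. *)
Definition mean01 (f : R -> R) : R := \int[@lebesgue_measure R]_(x in `[0, 1[) f x.

(** The fundamental theorem of calculus on the period interval. *)
Lemma mean01_primitive (f : R -> R) (F : R -> R) : continuous f ->
  (forall x : R, is_derive x 1 F (f x)) -> mean01 f = F 1 - F 0.
Proof.
move=> cf dF; rewrite /mean01 Rintegral_itv_bndo_bndc; last first.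
  have ci := @continuous_compact_integrable R f `[0, 1]%classic
   (@segment_compact R 0 1) (continuous_subspaceT cf).
  by apply: integrableS ci => //; by move=> x /=; rewrite !in_itv /= => /andP[-> /ltW ->].
have dF' x : derivable F x 1 by have [] := dF x.
have cF : continuous F.
  by move=> x; apply/differentiable_continuous/derivable1_diffP.
rewrite /Rintegral (@continuous_FTC2 _ f F)//.
- by apply: continuous_subspaceT.
- split=> [x _//||].
  + exact/cvg_at_right_filter/cF.
  + exact/cvg_at_left_filter/cF.
- by move=> x _; rewrite derive1E; exact: derive_val.
Qed.

Lemma is_derive_lin (c x : R) : is_derive x 1 (fun t : R => c * t) c.
Proof.
have := is_deriveZ c (is_derive_id x 1).
by move=> h; apply: (is_derive_eq h); rewrite scaler1.
Qed.

Lemma continuous_lin (c : R) : continuous (fun t : R => c * t).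
Proof. by move=> x; apply: cvgM; [exact: cvg_cst|exact: cvg_id]. Qed.

Lemma mean01_cos (n : int) : mean01 (fun x => cos (2 * pi * n%:~R * x)) = (n == 0)%:R.
Proof.
have [->|n0] := eqVneq n 0.
  under [mean01 _]eq_Rintegral do rewrite mulr0 mul0r cos0.
  rewrite Rintegral_cst//.
  by have /= -> := @lebesgue_measure_itv R `[0, 1[; rewrite lte_fin ltr01 sube0 mulr1.
set c := 2 * pi * n%:~R.
have c0 : c != 0 :> R by rewrite /c mulf_neq0 ?intr_eq0// mulf_neq0 ?pnatr_eq0// gt_eqF ?pi_gt0.
have dF (x : R) : is_derive x 1 (fun x => c^-1 * sin (c * x)) (cos (c * x)).
  have h := is_deriveZ c^-1 (is_derive1_comp (is_derive_sin (c * x)) (is_derive_lin c x)).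
  by apply: (is_derive_eq h); rewrite -[LHS]/(c^-1 * (cos (c * x) * c)) mulrCA mulVf// mulr1.
rewrite (mean01_primitive _ dF).
  by rewrite !mulr0 mulr1 sin0 sin_2piz subrr.
by move=> x; apply: continuous_comp; [exact: continuous_lin|exact: continuous_cos].
Qed.

Lemma mean01_sin (n : int) : mean01 (fun x => sin (2 * pi * n%:~R * x)) = 0.
Proof.
have [->|n0] := eqVneq n 0.
  under [mean01 _]eq_Rintegral do rewrite mulr0 mul0r sin0.
  by rewrite Rintegral_cst// mul0r.
set c := 2 * pi * n%:~R.
have c0 : c != 0 :> R by rewrite /c mulf_neq0 ?intr_eq0// mulf_neq0 ?pnatr_eq0// gt_eqF ?pi_gt0.
have dF (x : R) : is_derive x 1 (fun x => - c^-1 * cos (c * x)) (sin (c * x)).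
  have h := is_deriveZ (- c^-1) (is_derive1_comp (is_derive_cos (c * x)) (is_derive_lin c x)).
  by apply: (is_derive_eq h); rewrite -[LHS]/(- c^-1 * (- sin (c * x) * c)); field.
rewrite (mean01_primitive _ dF).
  by rewrite !mulr0 mulr1 cos0 cos_2piz subrr.
by move=> x; apply: continuous_comp; [exact: continuous_lin|exact: continuous_sin].
Qed.

(** Fubini for a product of functions of one variable. Boundedness by 1 is all
    that is needed for sines and cosines. *)
Lemma tmean_prod (f g : R -> R) : measurable_fun setT f -> measurable_fun setT g ->
  (forall x, `|f x| <= 1) -> (forall x, `|g x| <= 1) ->
  tmean (fun p => f p.1 * g p.2) = mean01 f * mean01 g.
Proof.
move=> mf mg f1 g1.
have mA : measurable (`[0 : R, 1[%classic : set (measurableTypeR R)) by exact: measurable_itv.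
have lA : (@lebesgue_measure R `[0%R, 1%R[%classic < +oo)%E.
  by have /= -> := @lebesgue_measure_itv R `[0, 1[; rewrite lte_fin ltr01 ltry.
have intA (h : R -> R) : measurable_fun setT h -> (forall x, `|h x| <= 1) ->
    (@lebesgue_measure R).-integrable `[0, 1[ (EFin \o h).
  move=> mh h1; apply: measurable_bounded_integrable => //.
    exact: measurable_funS mh.
  exists 1; split; first by rewrite realE ler01.
  by move=> y y1 x _ /=; rewrite (le_trans (h1 x))// ltW.
have intA' (h : R -> R) : measurable_fun setT h -> (forall x, `|h x| <= 1) ->
    (@lebesgue_measure R).-integrable setT (EFin \o (h \_ `[0, 1[)).
  move=> mh h1; rewrite -restrict_EFin.
  by apply/(integrable_mkcond _ mA).1; exact: intA.
have L : L1 (fun p : R * R => f p.1 * g p.2).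
  apply: (@L1_dom _ _ (fun=> 1)); last 2 first.
  - exact: L1_cst.
  - by move=> p _; rewrite normrM mulr_ile1.
  - apply: measurable_funM.
    + exact: (measurableT_comp mf measurable_fst).
    + exact: (measurableT_comp mg measurable_snd).
have Egx x : (\int[lebesgue_measure]_y ((f \_ `[0, 1[) x * (g \_ `[0, 1[) y)%:E = ((f \_ `[0,
  1[) x * mean01 g)%:E)%E.
  under eq_integral do rewrite EFinM.
  rewrite integralZl//; last first.
    exact: intA'.
  rewrite EFinM; congr (_ * _)%E.
  rewrite /mean01 Rintegral_mkcond /Rintegral fineK//.
  apply: integrable_fin_num => //=.
    exact: intA'.
rewrite /tmean Rintegral_mkcond /Rintegral.
have -> : (\int[leb2]_p (((fun p : R * R => f p.1 * g p.2) \_ cell) p)%:E =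
   \int[lebesgue_measure]_x \int[lebesgue_measure]_y ((f \_ `[0, 1[) x * (g \_ `[0, 1[) y)%:E)%E.
  rewrite /leb2 -integral12_prod_meas1; last first.
    have [_] := L.
    move=> /(integrable_mkcond _ (@measurable_cell R)).1.
    by rewrite restrict_EFin.
  apply: eq_integral => x _; apply: eq_integral => y _; congr EFin.
  rewrite !patchE /cell in_setX/=.
  by case: (x \in _); case: (y \in _); rewrite ?mulr0 ?mul0r.
under eq_integral do rewrite Egx.
rewrite -/(Rintegral _ _ _) RintegralZr//; last first.
    exact: intA'.
by rewrite -Rintegral_mkcond.
Qed.

(** The phase of the frequency [k] at the point [p]. The functions [cosk k] and
    [sink k], for [k] in Z x Z, form the real trigonometric system; it is used with
    redundancy, since opposite frequencies give the same functions up to sign. *)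
Definition theta k p : R := 2 * pi * (k.1%:~R * p.1 + k.2%:~R * p.2).
Definition cosk k p : R := cos (theta k p).
Definition sink k p : R := sin (theta k p).

Lemma thetaE k p : theta k p = 2 * pi * k.1%:~R * p.1 + 2 * pi * k.2%:~R * p.2.
Proof. by rewrite /theta; ring. Qed.

Lemma thetaD k l p : theta (k + l) p = theta k p + theta l p.
Proof. by rewrite /theta /= !intrD; ring. Qed.

Lemma thetaN k p : theta (- k) p = - theta k p.
Proof. by rewrite /theta /= !mulrNz; ring. Qed.

Lemma coskN k p : cosk (- k) p = cosk k p.
Proof. by rewrite /cosk thetaN cosN. Qed.

Lemma sinkN k p : sink (- k) p = - sink k p.
Proof. by rewrite /sink thetaN sinN. Qed.

Lemma coskM k l p : cosk k p * cosk l p = 2^-1 * cosk (k + l) p + 2^-1 * cosk (k - l) p.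
Proof. by rewrite /cosk !thetaD thetaN !cosD sinN cosN; field. Qed.

Lemma sinkM k l p : sink k p * sink l p = 2^-1 * cosk (k - l) p - 2^-1 * cosk (k + l) p.
Proof. by rewrite /cosk /sink !thetaD thetaN !cosD sinN cosN; field. Qed.

Lemma sinkcoskM k l p : sink k p * cosk l p = 2^-1 * sink (k + l) p + 2^-1 * sink (k - l) p.
Proof. by rewrite /cosk /sink !thetaD thetaN !sinD sinN cosN; field. Qed.

Lemma meas2_theta k : meas2 (theta k).
Proof.
apply: measurable_funM; first exact: measurable_cst.
apply: measurable_funD; apply: measurable_funM; (try exact: measurable_cst).
- exact: measurable_fst.
- exact: measurable_snd.
Qed.

Lemma measurable_sin : measurable_fun setT (@sin R).
Proof. by apply: continuous_measurable_fun; exact: continuous_sin. Qed.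

Lemma measurable_cos : measurable_fun setT (@cos R).
Proof. by apply: continuous_measurable_fun; exact: continuous_cos. Qed.

Lemma meas2_cosk k : meas2 (cosk k).
Proof. exact: (measurableT_comp measurable_cos (meas2_theta k)). Qed.

Lemma meas2_sink k : meas2 (sink k).
Proof. exact: (measurableT_comp measurable_sin (meas2_theta k)). Qed.

Lemma cosk_le1 k p : `|cosk k p| <= 1. Proof. exact: cos_max. Qed.
Lemma sink_le1 k p : `|sink k p| <= 1. Proof. exact: sin_max. Qed.

Lemma L2_cosk k : L2 (cosk k).
Proof. by apply: (@L2_bnd _ 1); [exact: meas2_cosk|move=> p _; exact: cosk_le1]. Qed.

Lemma L2_sink k : L2 (sink k).
Proof. by apply: (@L2_bnd _ 1); [exact: meas2_sink|move=> p _; exact: sink_le1]. Qed.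

Let mlin (f : R -> R) (c : R) : measurable_fun setT f -> measurable_fun setT (fun x => f (c * x)).
Proof.
move=> mf; apply: (measurableT_comp mf).
by apply: measurable_funM; [exact: measurable_cst|exact: measurable_id].
Qed.

Let L1prod (f g : R -> R) (c d : R) : measurable_fun setT f -> measurable_fun setT g ->
  (forall x, `|f x| <= 1) -> (forall x, `|g x| <= 1) ->
  L1 (fun p : R * R => f (c * p.1) * g (d * p.2)).
Proof.
move=> mf mg f1 g1; apply: (@L1_dom _ _ (fun=> 1)).
- apply: measurable_funM.
  + exact: (measurableT_comp (mlin c mf) measurable_fst).
  + exact: (measurableT_comp (mlin d mg) measurable_snd).
- exact: L1_cst.
- by move=> p _; rewrite normrM mulr_ile1.
Qed.

Lemma tmean_cosk k : tmean (cosk k) = (k == 0)%:R.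
Proof.
pose c := 2 * pi * k.1%:~R : R; pose d := 2 * pi * k.2%:~R : R.
have -> : cosk k = (fun p => cos (c * p.1) * cos (d * p.2) - sin (c * p.1) * sin (d * p.2)).
  by apply/funext => p; rewrite /cosk thetaE cosD.
have mc := measurable_cos; have ms := measurable_sin.
have bc := @cos_max R; have bs := @sin_max R.
rewrite tmeanB; [|exact: L1prod|exact: L1prod].
rewrite (@tmean_prod (fun x => cos (c * x)) (fun x => cos (d * x)))//; try exact: mlin.
rewrite (@tmean_prod (fun x => sin (c * x)) (fun x => sin (d * x)))//; try exact: mlin.
rewrite !mean01_cos !mean01_sin mulr0 subr0 -natrM mulnb.
by case: (k).
Qed.

Lemma tmean_sink k : tmean (sink k) = 0.
Proof.
pose c := 2 * pi * k.1%:~R : R; pose d := 2 * pi * k.2%:~R : R.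
have -> : sink k = (fun p => sin (c * p.1) * cos (d * p.2) + cos (c * p.1) * sin (d * p.2)).
  by apply/funext => p; rewrite /sink thetaE sinD.
have mc := measurable_cos; have ms := measurable_sin.
have bc := @cos_max R; have bs := @sin_max R.
rewrite tmeanD; [|exact: L1prod|exact: L1prod].
rewrite (@tmean_prod (fun x => cos (c * x)) (fun x => sin (d * x)))//; try exact: mlin.
rewrite (@tmean_prod (fun x => sin (c * x)) (fun x => cos (d * x)))//; try exact: mlin.
by rewrite !mean01_sin mulr0 mul0r addr0.
Qed.

End Trig.

(** * Trigonometric polynomials and best approximation *)

Section TrigPoly.
Context {R : realType}.
Implicit Types (p : R * R) (k l : int * int) (f g u T : R * R -> R).

(** Real trigonometric polynomials, as the linear span of the trigonometric
    system; frequencies may be repeated. *)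
Inductive trigpoly : (R * R -> R) -> Prop :=
| trigpoly0 : trigpoly (fun=> 0)
| trigpoly_addcos a k f of trigpoly f : trigpoly (fun p => a * cosk k p + f p)
| trigpoly_addsin a k f of trigpoly f : trigpoly (fun p => a * sink k p + f p).

Lemma trigpolyD f g : trigpoly f -> trigpoly g -> trigpoly (fun p => f p + g p).
Proof.
move=> + tg; elim=> [|a k {}f _ ih|a k {}f _ ih].
- by rewrite (_ : (fun _ => _) = g)//; apply/funext => p; rewrite add0r.
- have := trigpoly_addcos a k ih; congr trigpoly; apply/funext => p; exact: addrA.
- have := trigpoly_addsin a k ih; congr trigpoly; apply/funext => p; exact: addrA.
Qed.

Lemma trigpolyZ c f : trigpoly f -> trigpoly (fun p => c * f p).
Proof.
elim=> [|a k {}f _ ih|a k {}f _ ih].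
- by have := trigpoly0; congr trigpoly; apply/funext => p; rewrite mulr0.
- by have := trigpoly_addcos (c * a) k ih; congr trigpoly; apply/funext => p; rewrite mulrDr mulrA.
- by have := trigpoly_addsin (c * a) k ih; congr trigpoly; apply/funext => p; rewrite mulrDr mulrA.
Qed.

Lemma trigpoly_cosk k : trigpoly (cosk k).
Proof. by have := trigpoly_addcos 1 k trigpoly0; congr trigpoly; apply/funext => p;
  rewrite mul1r addr0. Qed.

Lemma trigpoly_sink k : trigpoly (sink k).
Proof. by have := trigpoly_addsin 1 k trigpoly0; congr trigpoly; apply/funext => p;
  rewrite mul1r addr0. Qed.

Lemma trigpoly_cst c : trigpoly (fun=> c).
Proof.
have := trigpolyZ c (trigpoly_cosk 0); congr trigpoly; apply/funext => p.
by rewrite /cosk /theta !mul0r addr0 mulr0 cos0 mulr1.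
Qed.

Lemma trigpoly_coskM k f : trigpoly f -> trigpoly (fun p => cosk k p * f p).
Proof.
elim=> [|a l {}f _ ih|a l {}f _ ih].
- by have := trigpoly0; congr trigpoly; apply/funext => p; rewrite mulr0.
- have := trigpoly_addcos (a / 2) (k + l) (trigpoly_addcos (a / 2) (k - l) ih).
  by congr trigpoly; apply/funext => p; rewrite mulrDr mulrCA coskM; ring.
- have := trigpoly_addsin (a / 2) (l + k) (trigpoly_addsin (a / 2) (l - k) ih).
  by congr trigpoly; apply/funext => p; rewrite mulrDr mulrCA (mulrC (cosk k p) (sink l p))
    sinkcoskM; ring.
Qed.

Lemma trigpoly_sinkM k f : trigpoly f -> trigpoly (fun p => sink k p * f p).
Proof.
elim=> [|a l {}f _ ih|a l {}f _ ih].
- by have := trigpoly0; congr trigpoly; apply/funext => p; rewrite mulr0.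
- have := trigpoly_addsin (a / 2) (k + l) (trigpoly_addsin (a / 2) (k - l) ih).
  by congr trigpoly; apply/funext => p; rewrite mulrDr mulrCA sinkcoskM; ring.
- have := trigpoly_addcos (a / 2) (k - l) (trigpoly_addcos (- a / 2) (k + l) ih).
  by congr trigpoly; apply/funext => p; rewrite mulrDr mulrCA sinkM; ring.
Qed.

Lemma trigpolyM f g : trigpoly f -> trigpoly g -> trigpoly (fun p => f p * g p).
Proof.
move=> + tg; elim=> [|a k {}f _ ih|a k {}f _ ih].
- by have := trigpoly0; congr trigpoly; apply/funext => p; rewrite mul0r.
- have := trigpolyD (trigpolyZ a (trigpoly_coskM k tg)) ih; congr trigpoly; apply/funext => p.
  by rewrite mulrDl mulrA.
- have := trigpolyD (trigpolyZ a (trigpoly_sinkM k tg)) ih; congr trigpoly; apply/funext => p.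
  by rewrite mulrDl mulrA.
Qed.

Lemma trigpolyX n f : trigpoly f -> trigpoly (fun p => f p ^+ n).
Proof.
move=> tf; elim: n => [|n ih]; first exact: trigpoly_cst.
by have := trigpolyM tf ih; congr trigpoly; apply/funext => p; rewrite exprS.
Qed.

Lemma trigpolyB f g : trigpoly f -> trigpoly g -> trigpoly (fun p => f p - g p).
Proof.
move=> tf /(trigpolyZ (-1)) /(trigpolyD tf); congr trigpoly; apply/funext => p.
by rewrite mulN1r.
Qed.

Lemma trigpoly_sum (Ix : Type) (s : seq Ix) (F : Ix -> R * R -> R) :
  (forall i, trigpoly (F i)) -> trigpoly (fun p => \sum_(i <- s) F i p).
Proof.
move=> tF; elim: s => [|i s ih].
  by have := trigpoly0; congr trigpoly; apply/funext => p; rewrite big_nil.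
by have := trigpolyD (tF i) ih; congr trigpoly; apply/funext => p; rewrite big_cons.
Qed.

Lemma trigpoly_L2 f : trigpoly f -> L2 f.
Proof.
elim=> [|a k {}f _ ih|a k {}f _ ih].
- by apply: (@L2_bnd _ 0) => [|p _]; [exact: measurable_cst|rewrite normr0].
- by apply: L2D => //; apply: L2Z; exact: L2_cosk.
- by apply: L2D => //; apply: L2Z; exact: L2_sink.
Qed.

Lemma trigpoly_bnd f : trigpoly f -> exists c, forall p, `|f p| <= c.
Proof.
elim=> [|a k {}f _ [c fc]|a k {}f _ [c fc]].
- by exists 0 => p; rewrite normr0.
- exists (`|a| + c) => p; rewrite (le_trans (ler_normD _ _))// lerD//.
  by rewrite normrM ler_piMr// cosk_le1.
- exists (`|a| + c) => p; rewrite (le_trans (ler_normD _ _))// lerD//.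
  by rewrite normrM ler_piMr// sink_le1.
Qed.

(** Real Fourier coefficients, with the normalization of the complex ones: for
    real [u], the mean of the product of [u] with the character of
    frequency [k] is [cos_coef u k +i* sin_coef u k]. *)
Definition cos_coef u k : R := tmean (fun p => u p * cosk k p).
Definition sin_coef u k : R := tmean (fun p => u p * sink k p).

Lemma cos_coefN u k : cos_coef u (- k) = cos_coef u k.
Proof. by rewrite /cos_coef; under eq_fun do rewrite coskN. Qed.

Lemma sin_coefN u k : L2 u -> sin_coef u (- k) = - sin_coef u k.
Proof.
move=> u2; rewrite /sin_coef; under eq_fun do rewrite sinkN mulrN -mulN1r.
by rewrite tmeanZ ?mulN1r//; apply: L2M => //; exact: L2_sink.
Qed.

(** The integers of absolute value at most [N], and the square of frequencies of
    sup norm at most [N]. The square is stable under opposite, so that partial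
    Fourier sums over it are real. *)
Definition ibox (N : nat) : seq int := [seq i%:Z - N%:Z | i <- iota 0 N.*2.+1].
Definition box (N : nat) : seq (int * int) := [seq (a, b) | a <- ibox N, b <- ibox N].

Lemma mem_ibox N (a : int) : (a \in ibox N) = (`|a| <= N)%N.
Proof.
apply/mapP/idP.
  by case=> i; rewrite mem_iota add0n => /andP[_ iN] ->; lia.
move=> aN.
by exists (absz (a + N%:Z)); rewrite ?mem_iota; lia.
Qed.

Lemma mem_box N k : (k \in box N) = (`|k.1| <= N)%N && (`|k.2| <= N)%N.
Proof.
case: k => a b /=; rewrite -!mem_ibox; apply/allpairsP/andP.
  by case=> -[x y] /= [xN yN [-> ->]].
by move=> -[aN bN]; exists (a, b).
Qed.

Lemma uniq_box N : uniq (box N).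
Proof.
have ui : uniq (ibox N) by rewrite map_inj_uniq ?iota_uniq// => i j; lia.
by apply: allpairs_uniq => // -[a b] [c d] _ _ /=.
Qed.

Lemma box_opp N k : (- k \in box N) = (k \in box N).
Proof. by rewrite !mem_box /= !abszN. Qed.

Lemma sum_indicator (Ix : eqType) (s : seq Ix) (F : Ix -> R) (x : Ix) :
  uniq s -> x \in s -> \sum_(k <- s) F k * (k == x)%:R = F x.
Proof.
move=> us xs; rewrite (bigD1_seq x)//= eqxx mulr1 big1 ?addr0// => k /negPf ->.
by rewrite mulr0.
Qed.

(** The partial Fourier sum over the square [box N]. A nonzero frequency
    and its opposite contribute the same term, which compensates the factor 1/2 in
    the mean of [cosk k p ^+ 2]. *)
Definition fourier_sum u N p : R := \sum_(k <- box N) (cos_coef u k * cosk k p +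
  sin_coef u k * sink k p).

Lemma trigpoly_fourier_sum u N : trigpoly (fourier_sum u N).
Proof.
apply: trigpoly_sum => k; apply: trigpolyD; apply: trigpolyZ.
- exact: trigpoly_cosk.
- exact: trigpoly_sink.
Qed.

Lemma tmean_coskM k l : tmean (fun p => cosk k p * cosk l p) = 2^-1 * (k == - l)%:R +
  2^-1 * (k == l)%:R :> R.
Proof.
under eq_fun do rewrite coskM.
have h m := L2_L1 (@L2_cosk R m).
rewrite tmeanD; [|exact: L1Z|exact: L1Z].
by rewrite !tmeanZ// !tmean_cosk subr_eq0 addr_eq0.
Qed.

Lemma tmean_sinkM k l : tmean (fun p => sink k p * sink l p) =
  2^-1 * (k == l)%:R - 2^-1 * (k == - l)%:R :> R.
Proof.
under eq_fun do rewrite sinkM.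
have h m := L2_L1 (@L2_cosk R m).
rewrite tmeanB; [|exact: L1Z|exact: L1Z].
by rewrite !tmeanZ// !tmean_cosk subr_eq0 addr_eq0.
Qed.

Lemma tmean_sinkcoskM k l : tmean (fun p => sink k p * cosk l p) = 0 :> R.
Proof.
under eq_fun do rewrite sinkcoskM.
have h m := L2_L1 (@L2_sink R m).
rewrite tmeanD; [|exact: L1Z|exact: L1Z].
by rewrite !tmeanZ// !tmean_sink mulr0 addr0.
Qed.

Let fourier_sumM u N T p : fourier_sum u N p * T p =
  \sum_(k <- box N) (cos_coef u k * (cosk k p * T p) + sin_coef u k * (sink k p * T p)).
Proof.
by rewrite /fourier_sum big_distrl/=; apply: eq_bigr => k _; rewrite mulrDl !mulrA.
Qed.

(** A Fourier sum is paired with a function through the coefficients of the latter. *)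
Lemma tmean_fourier_sumM u N T : L2 T -> tmean (fun p => fourier_sum u N p * T p) =
  \sum_(k <- box N) (cos_coef u k * tmean (fun p => cosk k p * T p) +
    sin_coef u k * tmean (fun p => sink k p * T p)).
Proof.
move=> T2; under eq_fun do rewrite fourier_sumM.
have h1 k := L2M (@L2_cosk R k) T2; have h2 k := L2M (@L2_sink R k) T2.
rewrite tmean_sum; last by move=> k; apply: L1D; apply: L1Z.
by apply: eq_bigr => k _; rewrite tmeanD ?tmeanZ//; exact: L1Z.
Qed.

Lemma tmean_fourier_sum_cosk u N l : l \in box N ->
  tmean (fun p => fourier_sum u N p * cosk l p) = cos_coef u l.
Proof.
move=> lN; rewrite tmean_fourier_sumM; last exact: L2_cosk.
under eq_bigr do rewrite tmean_coskM tmean_sinkcoskM mulr0 addr0 mulrDr mulrA (mulrA _ 2^-1).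
rewrite big_split /= !sum_indicator ?uniq_box ?box_opp// cos_coefN.
by field.
Qed.

Lemma tmean_fourier_sum_sink u N l : L2 u -> l \in box N ->
  tmean (fun p => fourier_sum u N p * sink l p) = sin_coef u l.
Proof.
move=> u2 lN; rewrite tmean_fourier_sumM; last exact: L2_sink.
have h k : tmean (fun p => cosk k p * sink l p) = 0 :> R.
  by under eq_fun do rewrite mulrC; exact: tmean_sinkcoskM.
under eq_bigr do rewrite h tmean_sinkM mulr0 add0r mulrBr mulrA (mulrA _ 2^-1).
rewrite sumrB /= !sum_indicator ?uniq_box ?box_opp// sin_coefN//.
by field.
Qed.

Lemma orth_cosk u N l : L2 u -> l \in box N ->
  tmean (fun p => (u p - fourier_sum u N p) * cosk l p) = 0.
Proof.
move=> u2 lN; under eq_fun do rewrite mulrBl.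
have c2 := @L2_cosk R l; have P2 := trigpoly_L2 (trigpoly_fourier_sum u N).
by rewrite tmeanB; [rewrite tmean_fourier_sum_cosk// subrr|exact: L2M|exact: L2M].
Qed.

Lemma orth_sink u N l : L2 u -> l \in box N ->
  tmean (fun p => (u p - fourier_sum u N p) * sink l p) = 0.
Proof.
move=> u2 lN; under eq_fun do rewrite mulrBl.
have c2 := @L2_sink R l; have P2 := trigpoly_L2 (trigpoly_fourier_sum u N).
by rewrite tmeanB; [rewrite tmean_fourier_sum_sink// subrr|exact: L2M|exact: L2M].
Qed.

(** The remainder of a Fourier sum is orthogonal to any fixed trigonometric
    polynomial, as soon as the square contains the frequencies of the latter. *)
Lemma orth_trigpoly T : trigpoly T -> exists N0, forall u N, L2 u -> (N0 <= N)%N ->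
  tmean (fun p => (u p - fourier_sum u N p) * T p) = 0.
Proof.
have key a k f (e : R * R -> R) : L2 e -> (exists N0, forall u N, L2 u -> (N0 <= N)%N ->
  tmean (fun p => (u p - fourier_sum u N p) * f p) = 0) -> L2 f -> (forall u N, L2 u ->
    k \in box N ->
  tmean (fun p => (u p - fourier_sum u N p) * e p) = 0) -> exists N0, forall u N, L2 u ->
    (N0 <= N)%N ->
  tmean (fun p => (u p - fourier_sum u N p) * (a * e p + f p)) = 0.
  move=> e2 [N0 h] f2 he; exists (maxn N0 (maxn `|k.1| `|k.2|)) => u N u2.
  rewrite !geq_max => /and3P[N0N k1N k2N].
  have r2 : L2 (fun p => u p - fourier_sum u N p).
    by apply: L2B => //; exact/trigpoly_L2/trigpoly_fourier_sum.
  under eq_fun do rewrite mulrDr mulrCA.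
  rewrite tmeanD; [|by apply: L1Z; exact: L2M|exact: L2M].
  by rewrite tmeanZ ?h ?he ?mem_box ?k1N ?k2N ?mulr0 ?addr0//; exact: L2M.
elim=> [|a k f tf ih|a k f tf ih].
- by exists 0%N => u N _ _; under eq_fun do rewrite mulr0; rewrite tmean_cst.
- apply: (key _ k) => //; [exact: L2_cosk|exact: trigpoly_L2|].
  by move=> u N u2; exact: orth_cosk.
- apply: (key _ k) => //; [exact: L2_sink|exact: trigpoly_L2|].
  by move=> u N u2; exact: orth_sink.
Qed.

Lemma orth_fourier_sum u N : L2 u -> tmean (fun p =>
  (u p - fourier_sum u N p) * fourier_sum u N p) = 0.
Proof.
move=> u2; have r2 : L2 (fun p => u p - fourier_sum u N p).
  by apply: L2B => //; exact/trigpoly_L2/trigpoly_fourier_sum.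
under eq_fun do rewrite mulrC.
rewrite tmean_fourier_sumM// big_seq big1// => k kN.
have -> : tmean (fun p => cosk k p * (u p - fourier_sum u N p)) = 0.
  by under eq_fun do rewrite mulrC; exact: orth_cosk.
have -> : tmean (fun p => sink k p * (u p - fourier_sum u N p)) = 0.
  by under eq_fun do rewrite mulrC; exact: orth_sink.
by rewrite !mulr0 addr0.
Qed.

(** Partial Fourier sums are eventually better in the mean square than any given
    trigonometric polynomial, by Pythagoras. *)
Lemma best_approx u T : L2 u -> trigpoly T -> exists N0, forall N, (N0 <= N)%N ->
  tmean (fun p => (u p - fourier_sum u N p) ^+ 2) <= tmean (fun p => (u p - T p) ^+ 2).
Proof.
move=> u2 tT; have [N0 h] := orth_trigpoly tT; exists N0 => N NN.
have P2 := trigpoly_L2 (trigpoly_fourier_sum u N); have T2 := trigpoly_L2 tT.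
have r2 := L2B u2 P2; have PT := L2B P2 T2.
have -> : (fun p => (u p - T p) ^+ 2) = (fun p => (u p - fourier_sum u N p) ^+ 2 +
   (2 * ((u p - fourier_sum u N p) * fourier_sum u N p) +
     (-2 * ((u p - fourier_sum u N p) * T p) + (fourier_sum u N p - T p) ^+ 2))).
  by apply/funext => p; ring.
have a1 := L2_sqr r2; have a2 := L1Z 2 (L2M r2 P2); have a3 := L1Z (-2) (L2M r2 T2).
have a4 := L2_sqr PT.
rewrite tmeanD//; last by apply: L1D => //; exact: L1D.
rewrite tmeanD//; last exact: L1D.
rewrite tmeanD// tmeanZ ?orth_fourier_sum//; last exact: L2M.
rewrite tmeanZ ?h//; last exact: L2M.
by rewrite !mulr0 !add0r lerDl; apply: tmean_ge0 => p; exact: sqr_ge0.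
Qed.

(** Functions in the closure of trigonometric polynomials for the mean square
    distance. *)
Definition approximable f := forall e, 0 < e -> exists2 T,
  trigpoly T & tmean (fun p => (f p - T p) ^+ 2) < e.

Lemma approximable_fourier_sum u : L2 u -> approximable u ->
  (fun N => tmean (fun p => (u p - fourier_sum u N p) ^+ 2)) @ \oo --> (0 : R).
Proof.
move=> u2 au; apply/cvgrPdist_lt => e e0.
have [T tT Te] := au _ e0; have [N0 h] := best_approx u2 tT.
exists N0 => // N /= NN; rewrite sub0r normrN ger0_norm.
  exact: le_lt_trans (h _ NN) Te.
by apply: tmean_ge0 => p; exact: sqr_ge0.
Qed.

End TrigPoly.

(** * Density of trigonometric polynomials in square-integrable functions *)

Section Density.
Context {R : realType}.
Implicit Types (p : R * R) (k l : int * int) (f g u T : R * R -> R).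
Notation T2 := (measurableTypeR R * measurableTypeR R)%type.

Lemma tmean_sqrD f g : L2 f -> L2 g ->
  tmean (fun p => (f p + g p) ^+ 2) <= 2 * tmean (fun p => f p ^+ 2) + 2 * tmean (fun p => g p ^+
    2).
Proof.
move=> f2 g2; have a := L2_sqr f2; have b := L2_sqr g2.
rewrite -!tmeanZ// -tmeanD//; [|exact: L1Z|exact: L1Z].
apply: le_tmean; [exact/L2_sqr/L2D|by apply: L1D; exact: L1Z|].
move=> p _; have : 0 <= (f p - g p) ^+ 2 by exact: sqr_ge0.
by nra.
Qed.

Lemma approximable_trigpoly T : trigpoly T -> approximable T.
Proof.
move=> tT e e0; exists T => //.
by under eq_fun do rewrite subrr expr0n/=; rewrite tmean_cst.
Qed.

Lemma approximable_lim f : L2 f ->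
  (forall e, 0 < e -> exists g, [/\ L2 g,
    approximable g & tmean (fun p => (f p - g p) ^+ 2) < e]) ->
  approximable f.
Proof.
move=> f2 h e e0; have e4 : 0 < e / 4 by rewrite divr_gt0.
have [g [g2 ag fg]] := h _ e4; have [T tT gT] := ag _ e4; exists T => //.
have T2 := trigpoly_L2 tT.
have := tmean_sqrD (L2B f2 g2) (L2B g2 T2).
under [X in tmean X <= _ -> _]eq_fun do rewrite addrA subrK.
move=> /le_lt_trans; apply.
by move: fg gT; set x := tmean _; set y := tmean _; lra.
Qed.

Lemma approximableD f g : L2 f -> L2 g -> approximable f -> approximable g ->
  approximable (fun p => f p + g p).
Proof.
move=> f2 g2 af ag e e0; have e4 : 0 < e / 4 by rewrite divr_gt0.
have [T tT fT] := af _ e4; have [S tS gS] := ag _ e4.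
exists (fun p => T p + S p); first exact: trigpolyD.
have := tmean_sqrD (L2B f2 (trigpoly_L2 tT)) (L2B g2 (trigpoly_L2 tS)).
under [X in tmean X <= _ -> _]eq_fun do rewrite addrACA -opprD.
move=> /le_lt_trans; apply.
by move: fT gS; set x := tmean _; set y := tmean _; lra.
Qed.

Lemma tmean_sqrM_le c f g : L2 f -> meas2 g -> (forall p, cell p -> `|g p| <= c) ->
  tmean (fun p => (f p * g p) ^+ 2) <= c ^+ 2 * tmean (fun p => f p ^+ 2).
Proof.
move=> f2 mg gc; rewrite -tmeanZ; last exact: L2_sqr.
apply: le_tmean; [exact/L2_sqr/(L2_bndM f2 mg gc)|exact/L1Z/L2_sqr|].
move=> p cp; rewrite exprMn mulrC ler_wpM2r ?sqr_ge0//.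
by move: (gc _ cp); rewrite ler_norml => /andP[? ?]; nra.
Qed.

Lemma approximableM_trigpoly f S : L2 f -> approximable f -> trigpoly S ->
  approximable (fun p => f p * S p).
Proof.
move=> f2 af tS e e0; have [c Sc] := trigpoly_bnd tS.
have c1 : 0 < c ^+ 2 + 1 by rewrite ltr_wpDl// sqr_ge0.
have [T tT fT] := af _ (divr_gt0 e0 c1).
exists (fun p => T p * S p); first exact: trigpolyM.
under eq_fun do rewrite -mulrBl.
have := tmean_sqrM_le (L2B f2 (trigpoly_L2 tT)) (proj1 (trigpoly_L2 tS)) (fun p _ => Sc p).
move=> /le_lt_trans; apply.
move: fT; rewrite ltr_pdivlMr// mulrC; apply: le_lt_trans.
by rewrite ler_wpM2r ?lerDl// tmean_ge0// => p; exact: sqr_ge0.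
Qed.

Lemma approximableZ c f : L2 f -> approximable f -> approximable (fun p => c * f p).
Proof.
move=> f2 af; have := approximableM_trigpoly f2 af (trigpoly_cst c).
by congr approximable; apply/funext => p; rewrite mulrC.
Qed.

Lemma approximableB f g : L2 f -> L2 g -> approximable f -> approximable g ->
  approximable (fun p => f p - g p).
Proof.
move=> f2 g2 af ag.
have := approximableD f2 (L2Z (-1) g2) af (approximableZ (-1) g2 ag).
by congr approximable; apply/funext => p; rewrite mulN1r.
Qed.

(** A bounded approximable function times an approximable function is
    approximable: approximate the second factor first, then the product of the
    first one with a fixed, hence bounded, trigonometric polynomial. *)
Lemma approximableM c f g : L2 g -> meas2 f -> (forall p, cell p -> `|f p| <= c) ->
  approximable f -> approximable g -> approximable (fun p => f p * g p).
Proof.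
move=> g2 mf fc af ag; have f2 := L2_bnd mf fc.
apply: approximable_lim => [|e e0].
  have := L2_bndM g2 mf fc; congr L2; apply/funext => p; exact: mulrC.
have c1 : 0 < c ^+ 2 + 1 by rewrite ltr_wpDl// sqr_ge0.
have [T tT fT] := ag _ (divr_gt0 e0 c1).
exists (fun p => f p * T p); split; [| exact: approximableM_trigpoly |].
  have := L2_bndM (trigpoly_L2 tT) mf fc; congr L2; apply/funext => p; exact: mulrC.
have := tmean_sqrM_le (L2B g2 (trigpoly_L2 tT)) mf fc.
under eq_fun do rewrite mulrC mulrBr.
move=> /le_lt_trans; apply.
move: fT; rewrite ltr_pdivlMr// mulrC; apply: le_lt_trans.
by rewrite ler_wpM2r ?lerDl// tmean_ge0// => p; exact: sqr_ge0.
Qed.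

Lemma approximable_sum (Ix : Type) (s : seq Ix) (F : Ix -> R * R -> R) :
  (forall i, L2 (F i)) -> (forall i, approximable (F i)) ->
    approximable (fun p => \sum_(i <- s) F i p).
Proof.
move=> F2 aF; elim: s => [|i s ih].
  have := approximable_trigpoly trigpoly0; congr approximable; apply/funext => p;
    by rewrite big_nil.
have := approximableD (F2 i) (L2_sum s F2) (aF i) ih.
by congr approximable; apply/funext => p; rewrite big_cons.
Qed.

(** Approximability is preserved by dominated almost everywhere limits. *)
Lemma approximable_dominated (F : nat -> R * R -> R) f h : (forall n, meas2 (F n)) -> meas2 f ->
  L2 h -> (forall n p, cell p -> `|F n p| <= h p) ->
  (forall p, cell p -> `|f p| <= h p) ->
  {ae @leb2 R, forall p, cell p -> F ^~ p @ \oo --> f p} ->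
  (forall n, approximable (F n)) -> approximable f.
Proof.
move=> mF mf h2 Fh fh Ff aF.
have h0 p : cell p -> h p = `|h p|.
  by move=> cp; rewrite ger0_norm// (le_trans _ (fh _ cp)).
apply: approximable_lim => [|e e0].
  by apply: (L2_dom mf h2) => p cp; rewrite -h0// fh.
have /cvgrPdist_lt /(_ _ e0) [N _ /(_ N (leqnn _))] := L2_dominated mF mf h2 Fh fh Ff.
rewrite sub0r normrN => fN; exists (F N); split => //.
  by apply: (L2_dom (mF N) h2) => p cp; rewrite -h0// Fh.
apply: le_lt_trans fN; rewrite [leRHS]ger0_norm; last by apply: tmean_ge0 => p; exact: sqr_ge0.
by under eq_fun do rewrite -sqrrN opprB.
Qed.

Let bernoulli_ge (x : R) N : 0 <= x <= 1 -> 1 - N%:R * x <= (1 - x) ^+ N.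
Proof.
move=> /andP[x0 x1]; elim: N => [|N ih]; first by rewrite mul0r subr0 expr0.
rewrite exprSr; apply: le_trans (_ : (1 - N%:R * x) * (1 - x) <= _); last first.
  by rewrite ler_wpM2r// subr_ge0.
rewrite -natr1; have : 0 <= (N%:R : R) by []. 
by nra.
Qed.

Let bernoulli_le (x : R) N : 0 <= x <= 1 -> (1 - x) ^+ N * (1 + N%:R * x) <= 1.
Proof.
move=> /andP[x0 x1]; elim: N => [|N ih]; first by rewrite mul0r addr0 expr0 mulr1.
apply: le_trans ih; rewrite exprSr -mulrA ler_wpM2l ?exprn_ge0 ?subr_ge0//.
rewrite -natr1; have : 0 <= (N%:R : R) by [].
by nra.
Qed.

Let q_ge0_le1 (t : R) n : 0 <= t <= 1 -> 0 <= (1 - t ^+ n) ^+ (2 ^ n) <= 1.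
Proof.
move=> /andP[t0 t1]; have tn0 : 0 <= t ^+ n by rewrite exprn_ge0.
have tn1 : t ^+ n <= 1 by rewrite exprn_ile1.
by rewrite exprn_ge0 ?subr_ge0//= exprn_ile1 ?subr_ge0// gerBl.
Qed.

(** The polynomials (1 - t^n)^(2^n) converge on [0, 1], except at 1/2, to the
    indicator function of t < 1/2. Below 1/2 they are at least 1 - (2 t)^n. *)
Let q_cvg1 (t : R) : 0 <= t < 2^-1 ->
  (fun n => (1 - t ^+ n) ^+ (2 ^ n)) @ \oo --> (1 : R).
Proof.
move=> /andP[t0 t1].
have t01 : 0 <= t <= 1 by rewrite t0/=; lra.
apply: (@squeeze_cvgr _ _ _ _ (fun n => 1 - (2 * t) ^+ n) (fun=> 1)).
- apply: nearW => n; rewrite (andP (q_ge0_le1 n t01)).2 andbT.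
  rewrite exprMn -natrX; apply: bernoulli_ge.
  by case/andP: t01 => ? ?; rewrite exprn_ge0//= exprn_ile1.
- rewrite -[X in _ --> X]subr0; apply: cvgB; first exact: cvg_cst.
  apply: cvg_expr; rewrite ger0_norm ?mulr_ge0//; lra.
- exact: cvg_cst.
Qed.

(** Beyond 1/2 the same polynomials are bounded by (2 t)^(-n). *)
Let q_cvg0 (t : R) : 2^-1 < t <= 1 ->
  (fun n => (1 - t ^+ n) ^+ (2 ^ n)) @ \oo --> (0 : R).
Proof.
move=> /andP[t0 t1].
have tp : 0 < t by apply: lt_trans t0; rewrite invr_gt0.
have t01 : 0 <= t <= 1 by rewrite ltW.
apply: (@squeeze_cvgr _ _ _ _ (fun=> 0) (fun n => (2 * t)^-1 ^+ n)).
- apply: nearW => n; rewrite (andP (q_ge0_le1 n t01)).1/=.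
  rewrite exprVn exprMn -natrX -[leRHS]mul1r ler_pdivlMr; last first.
    by rewrite mulr_gt0// exprn_gt0.
  have h : 0 <= t ^+ n <= 1 by rewrite exprn_ge0 ?exprn_ile1// ltW.
  apply: le_trans (bernoulli_le (2 ^ n) h).
  by rewrite ler_wpM2l ?lerDr// (andP (q_ge0_le1 n t01)).1.
- exact: cvg_cst.
- apply: cvg_expr; rewrite ger0_norm ?invr_ge0 ?mulr_ge0 ?ltW// invf_lt1; lra.
Qed.

(** If [f] is almost everywhere the indicator of the set where the trigonometric
    polynomial [g] is less than 1/2, then [f] is approximable. *)
Lemma approximable_step g f (Z : set T2) : trigpoly g -> (forall p, cell p -> 0 <= g p <= 1) ->
  meas2 f ->
  (forall p, cell p -> `|f p| <= 1) -> measurable Z -> @leb2 R Z = 0%E ->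
  (forall p, cell p -> ~ Z p -> (g p < 2^-1 /\ f p = 1) \/ (2^-1 < g p /\ f p = 0)) ->
  approximable f.
Proof.
move=> tg g01 mf f1 mZ Z0 gf.
have tF n : trigpoly (fun p => (1 - g p ^+ n) ^+ (2 ^ n)).
  by apply: trigpolyX; apply: trigpolyB; [exact: trigpoly_cst|exact: trigpolyX].
apply: (@approximable_dominated (fun n p => (1 - g p ^+ n) ^+ (2 ^ n)) f (fun=> 1)) => //.
- by move=> n; have [] := trigpoly_L2 (tF n).
- exact: trigpoly_L2 (trigpoly_cst 1).
- move=> n p cp; have /andP[q0 q1] := q_ge0_le1 n (g01 _ cp).
  by rewrite ger0_norm.
- exists Z; split=> // p /= /not_implyP[cp nc]; apply: contrapT => nZ; apply: nc.
  have /andP[g0 g1] := g01 _ cp.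
  case: (gf _ cp nZ) => -[gp ->].
    by apply: q_cvg1; rewrite g0.
  by apply: q_cvg0; rewrite gp.
- by move=> n; exact: approximable_trigpoly.
Qed.

Let trig_id (x y z w : R) : 2^-1 - 2^-1 * (y * w * x - z * (1 - x ^+ 2)) =
  2^-1 + 4^-1 * z - (4^-1 * z * (x ^+ 2 *+ 2 - 1) + 4^-1 * w * (x * y *+ 2)).
Proof.
by field.
Qed.

(** The indicator function of a coordinate half plane is approximable. Here [c] is
    one of the two coordinates and [e] the corresponding unit frequency. *)
Lemma approximable_ray (c : R * R -> R) e (a : R) : (forall p, theta e p = 2 * pi * c p) ->
  (forall p, cell p -> 0 <= c p < 1) -> measurable_fun (setT : set T2) c ->
  (forall b, @leb2 R (c @^-1` [set b]) = 0%E) ->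
  approximable (\1_(c @^-1` `]-oo, a[) : R * R -> R).
Proof.
move=> he c01 mc null.
have mray b : measurable (c @^-1` `]-oo, b[ : set T2).
  by rewrite -[X in measurable X]setTI; apply: mc => //; exact: measurable_itv.
have mpt b : measurable (c @^-1` [set b] : set T2).
  by rewrite -[X in measurable X]setTI; apply: mc => //; exact: measurable_set1.
have m1 : meas2 (\1_(c @^-1` `]-oo, a[) : R * R -> R) by exact: measurable_indic.
have indE p : (\1_(c @^-1` `]-oo, a[) p : R) = ((c p < a)%R)%:R.
  by rewrite indicE (_ : (p \in _) = (c p < a)%R)//; apply/idP/idP; rewrite inE/= in_itv.
have b1 p : cell p -> `|\1_(c @^-1` `]-oo, a[) p : R| <= 1.
  by rewrite indE; case: (_ < _); rewrite ?normr1 ?normr0.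
have [a0|a0] := leP a 0.
  apply: (@approximable_step (fun=> 1) _ set0) => //; first exact: trigpoly_cst.
  - by move=> p _; rewrite ler01 lexx.
  - move=> p cp _; right; split; first by rewrite invf_lt1// ltr1n.
    by have /andP[h _] := c01 _ cp; rewrite indE ltNge (le_trans a0 h).
have [a1|a1] := leP 1 a.
  apply: (@approximable_step (fun=> 0) _ set0) => //; first exact: trigpoly_cst.
  - by move=> p _; rewrite ler01 lexx.
  - move=> p cp _; left; split; first by rewrite invr_gt0.
    by have /andP[_ h] := c01 _ cp; rewrite indE (lt_le_trans h a1).
(* A trigonometric polynomial with values in [0, 1] that is below 1/2 exactly when
   c p < a: on ]0, 1[ the factor sin (pi x) is positive, and sin (pi (a - x)) has the
   sign of a - x. *)
pose g p : R := 2^-1 - 2^-1 * (sin (pi * c p) * sin (pi * (a - c p))).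
apply: (@approximable_step g _ (c @^-1` [set 0] `|` c @^-1` [set a])) => //.
- pose h p := 2^-1 + 4^-1 * cos (pi * a) - (4^-1 * cos (pi * a) * cosk e p +
    4^-1 * sin (pi * a) * sink e p).
  rewrite (_ : g = h).
    apply: trigpolyB; first exact: trigpoly_cst.
    by apply: trigpolyD; apply: trigpolyZ; [exact: trigpoly_cosk|exact: trigpoly_sink].
  apply/funext => p; rewrite /g /h /cosk /sink he.
  rewrite (_ : 2 * pi * c p = (pi * c p) *+ 2); last by rewrite -mulr_natl; ring.
  rewrite cos_mulr2n sin_mulr2n mulrBr sinB.
  have := cos2Dsin2 (pi * c p).
  set x := cos (pi * c p); set y := sin (pi * c p); set z := cos (pi * a); set w := sin (pi * a).
  move=> xy; have -> : y * (w * x - z * y) = y * w * x - z * (y ^+ 2) by ring.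
  have -> : y ^+ 2 = 1 - x ^+ 2 by rewrite -xy; ring.
  exact: trig_id.
- move=> p cp; rewrite /g; have := sin_max (pi * c p); have := sin_max (pi * (a - c p)).
  set x := sin _; set y := sin _ => h1 h2.
  have : `|y * x| <= 1 by rewrite normrM mulr_ile1.
  by rewrite ler_norml => /andP[? ?]; lra.
- exact: measurableU.
- by rewrite null_set_setU.
- move=> p cp nZ; have /andP[c0 c1] := c01 _ cp.
  have c0' : 0 < c p.
    by rewrite lt_neqAle c0 andbT; apply/eqP => h; apply: nZ; left.
  have ca : c p != a by apply/eqP => h; apply: nZ; right.
  have pi0 := pi_gt0 R.
  have s1 : 0 < sin (pi * c p).
    by apply: sin_gt0_pi; rewrite mulr_gt0//= gtr_pMr.
  rewrite indE /g; have [cla|acl] := ltP (c p) a.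
  + left; split=> //.
    have s2 : 0 < sin (pi * (a - c p)).
      apply: sin_gt0_pi; rewrite mulr_gt0 ?subr_gt0//= gtr_pMr//; lra.
    by have := mulr_gt0 s1 s2; lra.
  + right; split=> //.
    have acl' : a < c p by rewrite lt_neqAle eq_sym ca.
    have s2 : 0 < sin (pi * (c p - a)).
      apply: sin_gt0_pi; rewrite mulr_gt0 ?subr_gt0//= gtr_pMr//; lra.
    have := mulr_gt0 s1 s2; rewrite -(opprB a) mulrN sinN mulrN; lra.
Qed.

(** Measurable sets with approximable indicator function. They form a
    sigma-algebra, which contains the coordinate half planes and hence all measurable sets. *)
Definition approximable_set : set (set T2) :=
  [set B | measurable B /\ approximable (\1_B : R * R -> R)].

Lemma meas2_indic (B : set T2) : measurable B -> meas2 (\1_B : R * R -> R).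
Proof. by move=> mB; exact: measurable_indic. Qed.

Lemma L2_indic (B : set T2) : measurable B -> L2 (\1_B : R * R -> R).
Proof.
move=> mB; apply: (@L2_bnd _ 1); first exact: meas2_indic.
by move=> p _; rewrite indicE; case: (_ \in _); rewrite ?normr1 ?normr0.
Qed.

Lemma approximable_set0 : approximable_set set0.
Proof.
split=> //; have := approximable_trigpoly trigpoly0; congr approximable; apply/funext => p.
by rewrite indicE in_set0.
Qed.

Lemma approximable_setC B : approximable_set B -> approximable_set (~` B).
Proof.
move=> [mB aB]; split; first exact: measurableC.
have := approximableB (trigpoly_L2 (trigpoly_cst 1)) (L2_indic mB) (approximable_trigpoly
  (trigpoly_cst 1)) aB.
congr approximable; apply/funext => p; rewrite !indicE in_setC.
by case: (_ \in _); rewrite /= ?subrr ?subr0.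
Qed.

Lemma approximable_setI B C : approximable_set B -> approximable_set C ->
  approximable_set (B `&` C).
Proof.
move=> [mB aB] [mC aC]; split; first exact: measurableI.
have b1 p : cell p -> `|\1_B p : R| <= 1.
  by rewrite indicE; case: (_ \in _); rewrite ?normr1 ?normr0.
have := approximableM (L2_indic mC) (meas2_indic mB) b1 aB aC.
by congr approximable; apply/funext => p; rewrite !indicE in_setI -natrM mulnb.
Qed.

Lemma approximable_bigcup (F : nat -> set T2) : (forall n, approximable_set (F n)) ->
  approximable_set (\bigcup_n F n).
Proof.
move=> aF; pose G n := \big[setU/set0]_(i < n) F i.
have aG n : approximable_set (G n).
  rewrite /G; elim: n => [|n ih]; first by rewrite big_ord0; exact: approximable_set0.
  rewrite big_ord_recr /= -[X in approximable_set X]setCK setCU.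
  by apply: approximable_setC; apply: approximable_setI; exact: approximable_setC.
have mU : measurable (\bigcup_n F n) by apply: bigcup_measurable => n _; have [] := aF n.
split=> //; apply: (@approximable_dominated (fun n => \1_(G n)) _ (fun=> 1)).
- by move=> n; apply: meas2_indic; have [] := aG n.
- exact: meas2_indic.
- exact: trigpoly_L2 (trigpoly_cst 1).
- by move=> n p _; rewrite indicE; case: (_ \in _); rewrite ?normr1 ?normr0.
- by move=> p _; rewrite indicE; case: (_ \in _); rewrite ?normr1 ?normr0.
- apply: aeW => p cp; have [[i _ Fip]|nU] := pselect ((\bigcup_n F n) p).
    apply: (@cvg_near_cst); exists i.+1 => // n /= ni.
    apply/esym; rewrite !indicE (mem_set (ex_intro2 _ _ i Logic.I Fip)) mem_set// /G.
    by rewrite -bigcup_mkord; exists i.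
  apply: (@cvg_near_cst); apply: nearW => n.
  apply/esym; rewrite !indicE !memNset// /G -bigcup_mkord => -[i _ Fip].
  by apply: nU; exists i.
- by move=> n; have [] := aG n.
Qed.

Lemma approximable_sigma_algebra : sigma_algebra setT approximable_set.
Proof.
split; first exact: approximable_set0.
- by move=> B; rewrite setTD; exact: approximable_setC.
- exact: approximable_bigcup.
Qed.

Lemma approximable_preimage (c : R * R -> R) : measurable_fun (setT : set T2) c ->
  (forall a, approximable (\1_(c @^-1` `]-oo, a[) : R * R -> R)) ->
  forall A : set (measurableTypeR R), measurable A -> approximable_set (c @^-1` A).
Proof.
move=> mc h A mA.
have : (@RGenInftyO.G R).-sigma.-measurable A by rewrite -RGenInftyO.measurableE.
apply: (@smallest_sub _ _ _ [set B | approximable_set (c @^-1` B)]).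
- have [a b d] := approximable_sigma_algebra; split => /=.
  + by rewrite preimage_set0.
  + by move=> B /b; rewrite !setTD preimage_setC.
  + by move=> F /d; rewrite preimage_bigcup.
- move=> _ [x ->]; split => //.
  by rewrite -[X in measurable X]setTI; apply: mc => //; exact: measurable_itv.
Qed.

Lemma approximable_measurable (B : set T2) : measurable B -> approximable_set B.
Proof.
apply: smallest_sub; first exact: approximable_sigma_algebra.
have l0 (b : R) : @lebesgue_measure R [set b] = 0%E by exact: lebesgue_measure_set1.
rewrite subUset; split=> _ [A mA <-]; rewrite setTI.
- apply: approximable_preimage => //.
  move=> a; apply: (@approximable_ray _ (1, 0)).
  + by move=> p; rewrite /theta/= mul0r addr0 mul1r.
  + by move=> p [/= + _]; rewrite in_itv.
  + exact: measurable_fst.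
  + move=> b; rewrite (_ : _ @^-1` _ = [set b] `*` setT).
      rewrite /leb2 /= product_measure1E//.
      by rewrite [X in (X * _)%E](l0 b) mul0e.
    by apply/seteqP; split=> p /=; [split|case].
- apply: approximable_preimage => //.
  move=> a; apply: (@approximable_ray _ (0, 1)).
  + by move=> p; rewrite /theta/= mul0r add0r mul1r.
  + by move=> p [/= _ +]; rewrite in_itv.
  + exact: measurable_snd.
  + move=> b; rewrite (_ : _ @^-1` _ = setT `*` [set b]).
      rewrite /leb2 /= product_measure1E//.
      by rewrite [X in (_ * X)%E](l0 b) mule0.
    by apply/seteqP; split=> p /=; [split|case].
Qed.

Import HBNNSimple.

Lemma approximable_nnsfun (f : {nnsfun T2 >-> R}) : approximable (f : R * R -> R).
Proof.
have -> : (f : R * R -> R) = (fun p => \sum_(y <- finmap.enum_fset (fset_set (range f))) y *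
  \1_(f @^-1` [set y]) p).
  by apply/funext => p; rewrite [LHS]fimfunE fsbig_finite.
have mp y : measurable (f @^-1` [set y] : set T2) by exact: measurable_sfunP.
apply: approximable_sum => y; first by apply: L2Z; exact: L2_indic.
by apply: approximableZ; [exact: L2_indic|have [] := approximable_measurable (mp y)].
Qed.

Lemma approximable_ge0 f : L2 f -> (forall p, 0 <= f p) -> approximable f.
Proof.
move=> f2 f0; have mf := f2.1.
have mf' : measurable_fun (@cell R : set T2) (EFin \o f) by apply/measurable_EFinP; exact: meas2S.
have le n p : cell p -> nnsfun_approx (@measurable_cell R) mf' n p <= f p.
  by move=> cp; rewrite -lee_fin nnsfun_approxE le_approx// => x _; rewrite lee_fin.
apply: (@approximable_dominated (fun n => nnsfun_approx (@measurable_cell R) mf' n) f f) => //.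
- by move=> n; exact: measurable_funP.
- by move=> n p cp; rewrite ger0_norm ?le.
- by move=> p cp; rewrite ger0_norm.
- apply: aeW => p cp.
  have := @cvg_nnsfun_approx _ _ _ _ (@measurable_cell R) _ mf' _ p cp.
  move=> /(_ (fun x _ => _)) h.
  have {}h := h (fun x => f0 x).
  exact: (fine_cvg h).
- by move=> n; exact: approximable_nnsfun.
Qed.

Lemma approximable_L2 u : L2 u -> approximable u.
Proof.
move=> u2; have mu := u2.1.
have u02 : L2 (fun p => (`|u p| + u p) / 2).
  under eq_fun do rewrite mulrC; apply: L2Z; apply: L2D => //.
  by apply: (L2_dom _ u2) => [|p _]; [exact: measurableT_comp|rewrite normr_id].
have v02 : L2 (fun p => (`|u p| - u p) / 2).
  under eq_fun do rewrite mulrC; apply: L2Z; apply: L2B => //.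
  by apply: (L2_dom _ u2) => [|p _]; [exact: measurableT_comp|rewrite normr_id].
have a1 := approximable_ge0 u02 _; have a2 := approximable_ge0 v02 _.
have := approximableB u02 v02 (a1 _) (a2 _).
have -> : (fun p => (`|u p| + u p) / 2 - (`|u p| - u p) / 2) = u.
  by apply/funext => p; field.
apply=> p; rewrite divr_ge0//.
- by have := ler_norm (- u p); rewrite normrN; lra.
- by have := ler_norm (u p); lra.
Qed.

(** Completeness of the trigonometric system: the Fourier sums of a
    square-integrable function converge to it in the mean square. *)
Lemma fourier_sum_cvg u : L2 u -> (fun N => tmean (fun p => (u p - fourier_sum u N p) ^+
  2)) @ \oo --> (0 : R).
Proof. by move=> u2; apply: approximable_fourier_sum => //; exact: approximable_L2. Qed.

End Density.

(** * Bounded sums over the frequency lattice and the parabolic weight *)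

Section Summability.
Context {R : realType}.
Implicit Types (k : int * int) (F G : int * int -> R) (s : seq (int * int)).

(** All finite partial sums of the family [F] are at most [M]. For nonnegative
    families this is summability with total sum at most [M]. *)
Definition sum_bounded F (M : R) := forall s, uniq s -> \sum_(k <- s) F k <= M.

Lemma sub_box_ex s : exists N, {subset s <= box N}.
Proof.
elim: s => [|k s [N sN]]; first by exists 0%N.
exists (maxn N (maxn `|k.1| `|k.2|)) => l; rewrite inE mem_box => /predU1P[->|/sN].
  by rewrite !leq_max !leqnn !orbT.
by rewrite mem_box => /andP[a b]; rewrite !leq_max a b.
Qed.

Lemma sum_subset F s t : uniq s -> {subset s <= t} -> uniq t -> (forall k, 0 <= F k) ->
  \sum_(k <- s) F k <= \sum_(k <- t) F k.
Proof.
move=> us st ut F0.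
rewrite [leRHS](bigID (mem s))/= -[X in _ <= X + _]big_filter.
have -> : \sum_(k <- [seq k <- t | k \in s]) F k = \sum_(k <- s) F k.
  apply: perm_big; apply: uniq_perm; [exact: filter_uniq|by []|].
  move=> k; rewrite mem_filter; case ks: (k \in s) => //=.
  exact: st.
by rewrite lerDl sumr_ge0.
Qed.

Lemma sum_bounded_box F M : (forall k, 0 <= F k) -> (forall N, \sum_(k <- box N) F k <= M) ->
  sum_bounded F M.
Proof.
move=> F0 FM s us; have [N sN] := sub_box_ex s.
by apply: le_trans (FM N); apply: sum_subset => //; exact: uniq_box.
Qed.

Lemma sum_bounded_shift F M (l : int * int) s : sum_bounded F M -> uniq s ->
  \sum_(k <- s) F (k + l) <= M.
Proof.
move=> FM us; rewrite -(big_map (fun k => k + l) xpredT).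
by apply: FM; rewrite map_inj_uniq// => k k' /addIr.
Qed.

Lemma sum_bounded_le F G M : sum_bounded G M -> (forall k, F k <= G k) -> sum_bounded F M.
Proof. by move=> GM FG s us; apply: le_trans (GM s us); exact: ler_sum. Qed.

Lemma sum_boundedZ F M c : 0 <= c -> sum_bounded F M -> sum_bounded (fun k => c * F k) (c * M).
Proof. by move=> c0 FM s us; rewrite -mulr_sumr ler_wpM2l// FM. Qed.

Lemma sum_bounded_pt F M k : sum_bounded F M -> F k <= M.
Proof. by move=> /(_ [:: k] isT); rewrite big_seq1. Qed.

Let le_pow q (a b : R) : (0 < q)%N -> 0 <= a -> 0 <= b -> a ^+ q <= b ^+ q -> a <= b.
Proof. by move=> q0 a0 b0; rewrite ler_pXn2r. Qed.

Let pow_le q (a b : R) : 0 <= a -> a <= b -> a ^+ q <= b ^+ q.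
Proof. by move=> a0 ab; rewrite lerXn2r// nnegrE ?(le_trans a0). Qed.

(** The estimate that sums 1/n^(1 + 1/q): if x^q exceeds y^q by 1, then
    1/x^(q + 1) is at most q times the decrease 1/y - 1/x. *)
Lemma telescope_root q (x y : R) : (0 < q)%N -> 0 < y -> y <= x -> x ^+ q = y ^+ q + 1 ->
  (x ^+ q.+1)^-1 <= q%:R * (y^-1 - x^-1).
Proof.
move=> q0 y0 yx xy; have x0 : 0 < x by exact: lt_le_trans yx.
have q0' : 0 < q%:R :> R by rewrite ltr0n.
have h : 1 <= (x - y) * (q%:R * x ^+ q.-1).
  have e1 : 1 = x ^+ q - y ^+ q by rewrite xy addrC addKr.
  rewrite [leLHS]e1 subrXX ler_wpM2l ?subr_ge0//.
  apply: (@le_trans _ _ (\sum_(i < q) x ^+ q.-1)); last first.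
    by rewrite sumr_const card_ord mulr_natl.
  apply: ler_sum => i _.
  have -> : q.-1 = (q.-1 - i + i)%N by rewrite subnK// -ltnS prednK.
  rewrite [leRHS]exprD addnK ler_wpM2l ?exprn_ge0 ?(ltW x0)//.
  by apply: pow_le => //; exact: ltW.
have -> : y^-1 - x^-1 = (x - y) / (x * y).
  by field; rewrite !gt_eqF.
rewrite mulrA ler_pdivlMr ?mulr_gt0// mulrC.
have -> : x ^+ q.+1 = x ^+ q.-1 * (x * x) by rewrite -expr2 -exprD; congr (_ ^+ _); lia.
have e0 : 0 < x ^+ q.-1 by rewrite exprn_gt0.
rewrite ler_pdivrMr; last by rewrite !mulr_gt0.
have -> : q%:R * (x - y) * (x ^+ q.-1 * (x * x)) = (x - y) * (q%:R * x ^+ q.-1) * (x * x) by ring.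
apply: (@le_trans _ _ (1 * (x * x))); first by rewrite mul1r ler_pM2l.
by rewrite ler_wpM2r// mulr_ge0// ltW.
Qed.

(** The [q]-th root of a positive real number. *)
Definition nth_root q (a : R) : R := a `^ (q%:R^-1).

Lemma nth_root_gt0 q a : 0 < a -> 0 < nth_root q a. Proof. exact: powR_gt0. Qed.

Lemma nth_root_ge0 q a : 0 <= nth_root q a. Proof. exact: powR_ge0. Qed.

Lemma nth_rootK q a : (0 < q)%N -> 0 < a -> nth_root q a ^+ q = a.
Proof.
move=> q0 a0; rewrite /nth_root -powR_mulrn ?powR_ge0// -powRrM mulVf ?pnatr_eq0 -?lt0n//.
by rewrite powRr1// ltW.
Qed.

Lemma nth_root_ge1 q a : (0 < q)%N -> 1 <= a -> 1 <= nth_root q a.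
Proof.
move=> q0 a1; have a0 : 0 < a by apply: lt_le_trans a1.
by apply: (le_pow q0) => //; rewrite ?nth_root_ge0// expr1n nth_rootK.
Qed.

Lemma nth_root_le q a b : (0 < q)%N -> 0 < a -> 0 < b -> a <= b ^+ q -> nth_root q a <= b.
Proof.
move=> q0 a0 b0 ab.
by apply: (le_pow q0) => //; rewrite ?nth_root_ge0 ?nth_rootK// ltW.
Qed.

Lemma sum_nth_root q N : (0 < q)%N ->
  \sum_(i < N.+1) (nth_root q i.+1%:R ^+ q.+1)^-1 <= 1 + q%:R * (1 - (nth_root q N.+1%:R)^-1).
Proof.
move=> q0; elim: N => [|N ih].
  by rewrite big_ord_recl big_ord0 addr0 /nth_root powR1 expr1n invr1 subrr mulr0 addr0.
rewrite big_ord_recr/=; set x := nth_root q N.+2%:R; set y := nth_root q N.+1%:R in ih.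
have y0 : 0 < y by exact: nth_root_gt0.
have x0 : 0 < x by exact: nth_root_gt0.
have := @telescope_root q x y q0 y0.
have yx : y <= x by apply: nth_root_le => //; rewrite nth_rootK// ler_nat.
move=> /(_ yx); rewrite !nth_rootK// -natr1 => /(_ erefl).
by move: ih; rewrite !mulrBr; set z := \sum_(_ < _) _; lra.
Qed.

Lemma sum_nth_root_le q N : (0 < q)%N ->
  \sum_(i < N.+1) (nth_root q i.+1%:R ^+ q.+1)^-1 <= (1 + q%:R :> R).
Proof.
move=> q0; apply: le_trans (sum_nth_root N q0) _.
by rewrite lerD2l ler_piMr// gerBl invr_ge0 ltW// nth_root_gt0.
Qed.

Lemma sum_ibox (f : nat -> R) N : (forall i, 0 <= f i) ->
  \sum_(a <- ibox N) f `|a|%N <= 2 * \sum_(i < N.+1) f i.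
Proof.
move=> f0; rewrite mulr_natl mulr2n.
have hm : perm_eq (ibox N) ([seq - (i.+1)%:Z | i <- iota 0 N] ++ [seq i%:Z | i <- iota 0 N.+1]).
  apply: uniq_perm.
  - by rewrite map_inj_uniq ?iota_uniq// => i j; lia.
  - rewrite cat_uniq !map_inj_uniq ?iota_uniq//=; try by move=> i j; lia.
    rewrite andbT negb_or; apply/andP; split.
      by apply/negP => /mapP[j _]; lia.
    by apply/hasPn => _ /mapP[i _ ->]; apply/negP => /mapP[j _]; lia.
  - move=> a; rewrite mem_cat mem_ibox; apply/idP/orP.
      move=> aN; case: a aN => n nN; [right|left]; apply/mapP.
        by exists n; rewrite ?mem_iota//; lia.
      by exists n; rewrite ?mem_iota; lia.
    by case; move/mapP => -[x + ->]; rewrite mem_iota => /andP[_ xN]; lia.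
rewrite (perm_big _ hm) big_cat !big_map lerD//.
  have -> : \sum_(j <- iota 0 N) f `|- j.+1%:Z|%N = \sum_(i < N) f i.+1.
    rewrite -(big_mkord xpredT (fun i => f i.+1)) /index_iota subn0.
    by apply: eq_bigr => i _; congr f; lia.
  by rewrite big_ord_recl lerDr.
by rewrite -(big_mkord xpredT f) /index_iota subn0.
Qed.

(** The weight adapted to the symbol n^4 + m^2, for which [k.2] counts as much as
    the square of [k.1]. *)
Definition parabolic k : R := 1 + k.1%:~R ^+ 2 + `|k.2%:~R|.

(** The eighth root of the parabolic weight. Each step of the bootstrap gains one
    power of it, and taking the eighth root keeps all exponents integral. *)
Definition weight k : R := nth_root 8 (parabolic k).

Lemma parabolic_ge1 k : 1 <= parabolic k.
Proof. by rewrite /parabolic -addrA lerDl addr_ge0// sqr_ge0. Qed.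

Lemma weight_ge1 k : 1 <= weight k.
Proof. by apply: nth_root_ge1 => //; exact: parabolic_ge1. Qed.

Lemma weight_gt0 k : 0 < weight k.
Proof. exact: lt_le_trans (weight_ge1 k). Qed.

Lemma weight_ge0 k : 0 <= weight k.
Proof. exact: ltW (weight_gt0 k). Qed.

Lemma weight_expr8 k : weight k ^+ 8 = parabolic k.
Proof. by rewrite nth_rootK// (lt_le_trans ltr01 (parabolic_ge1 k)). Qed.

Lemma parabolicD k l : parabolic (k + l) <= 2 * (parabolic k + parabolic l).
Proof.
rewrite /parabolic /= !intrD.
have := ler_normD (k.2%:~R : R) l.2%:~R.
have : 0 <= (k.1%:~R - l.1%:~R : R) ^+ 2 by exact: sqr_ge0.
have := normr_ge0 (k.2%:~R : R); have := normr_ge0 (l.2%:~R : R).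
set a := `|k.2%:~R|; set b := `|l.2%:~R|; set c := `| _ |.
by nra.
Qed.

(** Quasi-subadditivity, with maximum instead of sum so that it passes to powers. *)
Lemma weightD k l : weight (k + l) <= 2 * Num.max (weight k) (weight l).
Proof.
have m0 : 0 < Num.max (weight k) (weight l) by rewrite lt_max weight_gt0.
apply: (@le_pow 8) => //; [exact: weight_ge0|by rewrite mulr_ge0// ltW|].
rewrite weight_expr8 exprMn.
apply: (le_trans (parabolicD k l)); rewrite -!weight_expr8.
have h1 : weight k ^+ 8 <= Num.max (weight k) (weight l) ^+ 8.
  by apply: pow_le; [exact: weight_ge0|rewrite le_max lexx].
have h2 : weight l ^+ 8 <= Num.max (weight k) (weight l) ^+ 8.
  by apply: pow_le; [exact: weight_ge0|rewrite le_max lexx orbT].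
have : 0 <= Num.max (weight k) (weight l) ^+ 8 by rewrite exprn_ge0// ltW.
by move: h1 h2; set x := _ ^+ 8; set y := weight l ^+ 8; set z := _ ^+ 8; rewrite -natrX; lra.
Qed.

Lemma weightXD j k l : weight (k + l) ^+ j <= 2 ^+ j * (weight k ^+ j + weight l ^+ j).
Proof.
have kj : 0 <= weight k ^+ j by rewrite exprn_ge0// ltW// weight_gt0.
have lj : 0 <= weight l ^+ j by rewrite exprn_ge0// ltW// weight_gt0.
have m0 : 0 < Num.max (weight k) (weight l) by rewrite lt_max weight_gt0.
apply: (@le_trans _ _ ((2 * Num.max (weight k) (weight l)) ^+ j)).
  by apply: pow_le; [exact: weight_ge0|exact: weightD].
rewrite exprMn ler_wpM2l ?exprn_ge0//.
by rewrite maxEle; case: ifP => _; rewrite ?lerDl ?lerDr.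
Qed.

Lemma weightN k : weight (- k) = weight k.
Proof. by rewrite /weight /parabolic /= !mulrNz sqrrN normrN. Qed.

(** The power 14 of [weight] is the power 7/4 of the parabolic weight, summable
    because the lattice has homogeneous dimension 3/2 for that weight. *)
Lemma sum_bounded_weight : exists M, sum_bounded (fun k => (weight k ^+ 14)^-1) M.
Proof.
exists (32 * ((2 * (1 + 4)) * (2 * (1 + 8)))).
apply: sum_bounded_box => [k|N]; first by rewrite invr_ge0 exprn_ge0// ltW// weight_gt0.
pose f i : R := (nth_root 4 i.+1%:R ^+ 5)^-1; pose g i : R := (nth_root 8 i.+1%:R ^+ 9)^-1.
have f0 i : 0 <= f i by rewrite invr_ge0 exprn_ge0// ltW// nth_root_gt0.
have g0 i : 0 <= g i by rewrite invr_ge0 exprn_ge0// ltW// nth_root_gt0.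
apply: (@le_trans _ _ (\sum_(k <- box N) 32 * (f `|k.1|%N * g `|k.2|%N))).
  apply: ler_sum => -[n m] _ /=; move: (weight_expr8 (n, m)) (weight_gt0 (n, m));
    move: (weight (n, m)) => v v8 v0.
  have an : (`|n|%N%:R : R) = `|n%:~R| by rewrite natr_absz -intr_norm.
  have am : (`|m|%N%:R : R) = `|m%:~R| by rewrite natr_absz -intr_norm.
  have hg : (v ^+ 9)^-1 <= g `|m|%N.
    rewrite lef_pV2 ?posrE ?exprn_gt0 ?nth_root_gt0//.
    apply: pow_le; first exact: nth_root_ge0.
    apply: nth_root_le => //; rewrite v8 /parabolic /= -natr1 am.
    by have := sqr_ge0 (n%:~R : R); lra.
  have hf : (v ^+ 5)^-1 <= 32 * f `|n|%N.
    have h : nth_root 4 `|n|.+1%:R <= 2 * v.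
      apply: (@le_pow 8) => //; [exact: nth_root_ge0|by rewrite mulr_ge0// ltW|].
      rewrite (_ : 8 = 4 * 2)%N// exprM nth_rootK// exprMn -(mulnC 2) -/(8)%N v8 /parabolic /=
        -natr1 an.
      have := normr_ge0 (m%:~R : R); have := sqr_ge0 (`|n%:~R| - 1 : R).
      rewrite -(real_normK (num_real (n%:~R : R))).
      set a := `|n%:~R|; set b := `|m%:~R|; rewrite -natrX; nra.
    rewrite /f -[32]invrK -invfM lef_pV2 ?posrE ?mulr_gt0 ?invr_gt0 ?exprn_gt0 ?nth_root_gt0//.
    rewrite mulrC ler_pdivrMr//.
    apply: (@le_trans _ _ ((2 * v) ^+ 5)).
      by apply: pow_le => //; exact: nth_root_ge0.
    by rewrite exprMn mulrC ler_wpM2l ?exprn_ge0 ?(ltW v0)// -natrX ler_nat.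
  (* v^-9 <= (1 + |m|)^(-9/8), because v^8 >= 1 + |m|, and
     v^-5 <= 32 (1 + |n|)^(-5/4), because (1 + |n|)^2 <= 2 v^8 *)
  have -> : v ^- 14 = v ^- 5 * v ^- 9 by rewrite -invfM -exprD.
  rewrite mulrA.
  by apply: ler_pM => //; rewrite invr_ge0 exprn_ge0// ltW.
rewrite -mulr_sumr ler_wpM2l// /box big_allpairs/=.
under eq_bigr do rewrite -mulr_sumr.
rewrite -mulr_suml; apply: ler_pM.
- exact: sumr_ge0.
- exact: sumr_ge0.
- by apply: (le_trans (sum_ibox N f0)); rewrite ler_pM2l// (sum_nth_root_le N (q := 4)).
- by apply: (le_trans (sum_ibox N g0)); rewrite ler_pM2l// (sum_nth_root_le N (q := 8)).
Qed.

End Summability.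

(** * The convolution estimate and the bootstrap *)

Section Bootstrap.
Context {R : realType}.
Implicit Types (k l : int * int) (u f : R * R -> R).

Lemma L1_bndM f g c : L1 f -> meas2 g -> (forall p : R * R, cell p -> `|g p| <= c) ->
  L1 (fun p => f p * g p).
Proof.
move=> f1 mg gc; have := L1Z c (L1_norm f1).
move=> /L1_dom; apply.
  by apply: measurable_funM => //; case: f1.
by move=> p cp; rewrite normrM mulrC ler_wpM2r// gc.
Qed.

(** The size of the Fourier coefficient of frequency [k]. *)
Definition amp u k : R := `|cos_coef u k| + `|sin_coef u k|.

Lemma amp_ge0 u k : 0 <= amp u k. Proof. by rewrite addr_ge0. Qed.

Lemma cos_coef_le_amp u k : `|cos_coef u k| <= amp u k. Proof. by rewrite lerDl. Qed.
Lemma sin_coef_le_amp u k : `|sin_coef u k| <= amp u k. Proof. by rewrite lerDr. Qed.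

(** Bessel's inequality. *)
Lemma bessel u : L2 u -> exists M, sum_bounded (fun k => amp u k ^+ 2) M.
Proof.
move=> u2; exists (2 * tmean (fun p => u p ^+ 2)).
apply: sum_bounded_box => [k|N]; first exact: sqr_ge0.
apply: (@le_trans _ _ (2 * \sum_(k <- box N) (cos_coef u k * cos_coef u k +
  sin_coef u k * sin_coef u k))).
  rewrite mulr_sumr; apply: ler_sum => k _; rewrite /amp.
  rewrite -!expr2 -(real_normK (num_real (cos_coef u k))) -(real_normK (num_real (sin_coef u k))).
  by have := sqr_ge0 (`|cos_coef u k| - `|sin_coef u k|); nra.
have P2 := trigpoly_L2 (trigpoly_fourier_sum u N); have r2 := L2B u2 P2.
have E : \sum_(k <- box N) (cos_coef u k * cos_coef u k + sin_coef u k * sin_coef u k) =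
  tmean (fun p => fourier_sum u N p * u p).
  rewrite tmean_fourier_sumM//; apply: eq_bigr => k _.
  by congr (_ * _ + _ * _); apply: eq_tmean => p _; rewrite mulrC.
rewrite E ler_pM2l//.
have : 0 <= tmean (fun p => (u p - fourier_sum u N p) ^+ 2) by apply: tmean_ge0 => p;
  exact: sqr_ge0.
have -> : (fun p => (u p - fourier_sum u N p) ^+ 2) = (fun p => u p ^+
  2 - fourier_sum u N p * u p - (u p - fourier_sum u N p) * fourier_sum u N p).
  by apply/funext => p; ring.
have a1 := L2_sqr u2; have a2 := L2M P2 u2; have a3 := L2M r2 P2.
by rewrite tmeanB ?tmeanB// ?orth_fourier_sum// ?subr0 ?subr_ge0//; exact: L1B.
Qed.

(** The pointwise square. *)
Definition sq u (p : R * R) : R := u p ^+ 2.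

(** The Fourier coefficients of the square of [u], with [e] one of the trigonometric
    functions, are limits of those of the product of [u] and its Fourier sums. The
    latter are finite convolutions of the Fourier coefficients of [u]. *)
Lemma sq_cvg u (e : R * R -> R) : L2 u -> meas2 e -> (forall p, `|e p| <= 1) ->
  (fun N => tmean (fun p => fourier_sum u N p * (u p * e p))) @ \oo -->
    tmean (fun p => sq u p * e p).
Proof.
move=> u2 me e1; apply/cvgrPdist_lt => eps eps0.
have ue2 : L2 (fun p => u p * e p) by apply: (L2_bndM u2 me (fun p _ => e1 p)).
pose Q := tmean (fun p => (u p * e p) ^+ 2).
have Q0 : 0 <= Q by apply: tmean_ge0 => p; exact: sqr_ge0.
(* l is large enough for l^-1 Q < eps / 2 *)
pose l : R := 2 * (Q + 1) / eps.
have l0 : 0 < l by rewrite divr_gt0// mulr_gt0// ltr_wpDl.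
have d0 : 0 < eps / 2 / l by rewrite divr_gt0// divr_gt0.
have /cvgrPdist_lt/(_ _ d0)[N0 _ h] := fourier_sum_cvg u2.
exists N0 => // N /= NN; have := h _ NN.
rewrite sub0r normrN ger0_norm; last by apply: tmean_ge0 => p; exact: sqr_ge0.
have P2 := trigpoly_L2 (trigpoly_fourier_sum u N); have r2 := L2B u2 P2.
have -> : tmean (fun p => sq u p * e p) - tmean (fun p => fourier_sum u N p * (u p * e p)) =
  tmean (fun p => (u p - fourier_sum u N p) * (u p * e p)).
  rewrite -tmeanB; [|by apply: L1_bndM (L2_sqr u2) me (fun p _ => e1 p)|exact: L2M].
  by apply: eq_tmean => p _; rewrite /sq; ring.
rewrite ltr_pdivlMr// mulrC => lh.
apply: (le_lt_trans (tmean_young l0 r2 ue2)).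
have : l^-1 * Q < eps / 2.
  rewrite /l invf_div mulrAC ltr_pdivrMr ?mulr_gt0 ?ltr_wpDl//; nra.
by rewrite -/Q; move: lh; set a := l * _; set b := l^-1 * _; lra.
Qed.

(** An even, quasi-subadditive weight can be distributed over the convolution that gives
    the Fourier coefficients of the square; Cauchy-Schwarz then bounds them by the
    weighted square sum of those of [u]. *)
Lemma conv_bound u (w : int * int -> R) C M : L2 u -> 0 <= C ->
  (forall k, 0 <= w k) -> (forall k, w (- k) = w k) ->
  (forall k l, w (k + l) <= C * (w k + w l)) ->
  sum_bounded (fun k => amp u k ^+ 2 * (1 + w k ^+ 2)) M ->
  forall k, `|cos_coef (sq u) k| * w k <= 2 * C * M /\ `|sin_coef (sq u) k| * w k <= 2 * C * M.
Proof.
move=> u2 C0 w0 wN wD sM k.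
(* w l is split along l = (p + l) - p; with a, b the values of amp u and x, y those of
   w at p and p + l, a b (x + y) <= ((a x)^2 + b^2 + a^2 + (b y)^2) / 2 is summed *)
have shift l N : \sum_(p <- box N) amp u p * amp u (p + l) * w l <= C * M.
  apply: (@le_trans _ _ (\sum_(p <- box N) (C / 2 * (amp u p ^+ 2 * (1 + w p ^+ 2)) +
     C / 2 * (amp u (p + l) ^+ 2 * (1 + w (p + l) ^+ 2))))).
    apply: ler_sum => p _.
    have wl : w l <= C * (w p + w (p + l)).
      by rewrite -(wN p) -[X in w X <= _](addKr p) addrC (addrC (w _)) wD.
    have := amp_ge0 u p; have := amp_ge0 u (p + l).
    set a := amp u p; set b := amp u (p + l); set x := w p in wl *; set y := w (p + l) in wl *.
    move=> b0 a0; apply: (@le_trans _ _ (a * b * (C * (x + y)))).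
      by rewrite ler_wpM2l// mulr_ge0.
    rewrite -mulrDr (_ : a * b * (C * (x + y)) = C / 2 * (2 * a * b * (x + y))); last by field.
    rewrite ler_wpM2l ?divr_ge0//.
    have := sqr_ge0 (a * x - b); have := sqr_ge0 (a - b * y); nra.
  rewrite big_split /= -!mulr_sumr.
  have h1 := sM _ (uniq_box N); have h2 := sum_bounded_shift l sM (uniq_box N).
  have C2 : 0 <= C / 2 by rewrite divr_ge0.
  have := ler_wpM2l C2 h1; have := ler_wpM2l C2 h2.
  by set x := _ * \sum_(_ <- _) _; set y := _ * \sum_(_ <- _) _; lra.
have total N : \sum_(p <- box N) amp u p * (amp u (p + k) + amp u (p - k)) * w k <= 2 * C * M.
  under eq_bigr do rewrite mulrDr mulrDl.
  rewrite big_split /= -(wN k).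
  have := shift (- k) N; have := shift k N; rewrite wN.
  by set x := \sum_(_ <- _) _; set y := \sum_(_ <- _) _; lra.
have key (e : R * R -> R) : meas2 e -> (forall p, `|e p| <= 1) ->
   (forall p, `|tmean (fun q => cosk p q * (u q * e q))| <= amp u (p + k) + amp u (p - k)) ->
   (forall p, `|tmean (fun q => sink p q * (u q * e q))| <= amp u (p + k) + amp u (p - k)) ->
   `|tmean (fun p => sq u p * e p)| * w k <= 2 * C * M.
  move=> me e1 hc hs.
  have cv : (fun N => `|tmean (fun p => fourier_sum u N p * (u p * e p))| * w k) @ \oo -->
      `|tmean (fun p => sq u p * e p)| * w k.
    by apply: cvgM; [exact: (cvg_norm (sq_cvg u2 me e1))|exact: cvg_cst].
  rewrite -(cvg_lim _ cv)//; apply: limr_le; first by apply/cvg_ex; eexists; exact: cv.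
  apply: nearW => N; apply: le_trans (total N).
  rewrite tmean_fourier_sumM; last exact: (L2_bndM u2 me (fun p _ => e1 p)).
  rewrite -mulr_suml ler_wpM2r//.
  apply: (le_trans (ler_norm_sum _ _ _)); apply: ler_sum => p _.
  apply: (le_trans (ler_normD _ _)); rewrite !normrM mulrDl.
  by apply: lerD; rewrite ler_wpM2l.
have La q : L1 (fun p => u p * cosk q p) by apply: L2M => //; exact: L2_cosk.
have Lb q : L1 (fun p => u p * sink q p) by apply: L2M => //; exact: L2_sink.
have nA q : `|cos_coef u q| <= amp u q by exact: cos_coef_le_amp.
have nB q : `|sin_coef u q| <= amp u q by exact: sin_coef_le_amp.
have half_sum_le (a b : R) : `|2^-1 * a + 2^-1 * b| <= `|a| + `|b|.
  apply: (le_trans (ler_normD _ _)); rewrite !normrM [`|2^-1|]ger0_norm//.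
  by have := normr_ge0 a; have := normr_ge0 b; lra.
have half_sum_le' (a b : R) : `|2^-1 * a - 2^-1 * b| <= `|b| + `|a|.
  by rewrite -mulrN addrC (le_trans (half_sum_le _ _))// normrN.
split; apply: key.
- exact: meas2_cosk.
- exact: cosk_le1.
- move=> p; rewrite (_ : tmean _ = 2^-1 * cos_coef u (p + k) + 2^-1 * cos_coef u (p - k)).
    by apply: (le_trans (half_sum_le _ _)); apply: lerD.
  rewrite -!tmeanZ// -tmeanD; [|exact: L1Z|exact: L1Z].
  by apply: eq_tmean => q _; rewrite mulrCA coskM; ring.
- move=> p; rewrite (_ : tmean _ = 2^-1 * sin_coef u (p + k) + 2^-1 * sin_coef u (p - k)).
    by apply: (le_trans (half_sum_le _ _)); apply: lerD.
  rewrite -!tmeanZ// -tmeanD; [|exact: L1Z|exact: L1Z].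
  by apply: eq_tmean => q _; rewrite mulrCA sinkcoskM; ring.
- exact: meas2_sink.
- exact: sink_le1.
- move=> p; rewrite (_ : tmean _ = 2^-1 * sin_coef u (k + p) + 2^-1 * sin_coef u (k - p)).
    apply: (le_trans (half_sum_le _ _)); rewrite -(opprB p k) sin_coefN// normrN (addrC k p).
    exact: lerD.
  rewrite -!tmeanZ// -tmeanD; [|exact: L1Z|exact: L1Z].
  by apply: eq_tmean => q _; rewrite mulrCA (mulrC (cosk p q)) sinkcoskM; ring.
- move=> p; rewrite (_ : tmean _ = 2^-1 * cos_coef u (p - k) - 2^-1 * cos_coef u (p + k)).
    by apply: (le_trans (half_sum_le' _ _)); apply: lerD.
  rewrite -!tmeanZ// -tmeanB; [|exact: L1Z|exact: L1Z].
  by apply: eq_tmean => q _; rewrite mulrCA sinkM; ring.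
Qed.

(** The relation that the equation imposes between the Fourier coefficients [a] of
    [u] and [b] of its square: for frequencies [k] = (n, m), [a] vanishes if
    n = 0, and
    (n^4 + m^2) |a(n, m)| <= n^2 |b(n, m)|. *)
Definition elliptic (a b : int * int -> R) := forall k,
  (k.1 = 0 -> a k = 0) /\
  (k.1%:~R ^+ 4 + k.2%:~R ^+ 2) * `|a k| <= k.1%:~R ^+ 2 * `|b k|.

(** For nonzero n, n^2 (1 + n^2 + |m|) <= 3 (n^4 + m^2): the relation gains a full
    power of the parabolic weight. *)
Lemma elliptic_gain a b k : elliptic a b -> `|a k| * weight k ^+ 8 <= 3 * `|b k|.
Proof.
move=> /(_ k)[a0 ab]; have [k0|k0] := eqVneq k.1 0.
  by rewrite a0// normr0 mul0r mulr_ge0.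
have n1 : 1 <= `|k.1%:~R : R| by rewrite -intr_norm ler1z -gtz0_ge1 normr_gt0.
rewrite weight_expr8 /parabolic; move: ab.
rewrite -(real_normK (num_real (k.2%:~R : R))).
have -> : (k.1%:~R ^+ 4 : R) = (`|k.1%:~R| ^+ 2) ^+ 2.
  by rewrite real_normK ?num_real// -exprM.
rewrite -(real_normK (num_real (k.1%:~R : R))).
have m0 := normr_ge0 (k.2%:~R : R).
set n := `|k.1%:~R| in n1 *; set m := `|k.2%:~R| in m0 *.
have := normr_ge0 (a k); have := normr_ge0 (b k).
set x := `|a k|; set y := `|b k| => y0 x0.
set N := n ^+ 2; have N1 : 1 <= N by rewrite -(expr1n _ 2) lerXn2r// nnegrE; lra.
move=> h.
have D0 : 0 < N ^+ 2 + m ^+ 2.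
  by rewrite ltr_wpDr ?sqr_ge0// exprn_gt0//; lra.
rewrite -(ler_pM2l D0).
apply: (@le_trans _ _ (N * y * (1 + N + m))).
  by rewrite mulrA ler_wpM2r//; lra.
rewrite (_ : N * y * (1 + N + m) = y * (N * (1 + N + m))); last by ring.
rewrite (_ : (N ^+ 2 + m ^+ 2) * (3 * y) = y * (3 * (N ^+ 2 + m ^+ 2))); last by ring.
rewrite ler_wpM2l//; have := sqr_ge0 (N - m); nra.
Qed.

(** The coefficients are square-summable against every power of [weight]: the step
    from [j] to [j.+1] is one application of [conv_bound] and one of
    [elliptic_gain]. *)
Lemma bootstrap u : L2 u -> elliptic (cos_coef u) (cos_coef (sq u)) ->
  elliptic (sin_coef u) (sin_coef (sq u)) ->
  forall j, exists M, sum_bounded (fun k => amp u k ^+ 2 * (weight k ^+ j) ^+ 2) M.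
Proof.
move=> u2 eA eB; elim=> [|j [M sM]].
  have [M sM] := bessel u2; exists M; apply: sum_bounded_le sM _ => k.
  by rewrite expr0 expr1n mulr1.
have V1 k : 1 <= weight k ^+ j :> R by rewrite exprn_ege1// weight_ge1.
have V0 k : 0 <= weight k ^+ j :> R by rewrite (le_trans _ (V1 k)).
have s2 : sum_bounded (fun k => amp u k ^+ 2 * (1 + (weight k ^+ j) ^+ 2)) (2 * M).
  apply: sum_bounded_le (sum_boundedZ _ sM) _ => // k; rewrite mulrCA ler_wpM2l ?sqr_ge0//.
  have : 1 <= (weight k ^+ j) ^+ 2 :> R by rewrite exprn_ege1.
  by lra.
have cb := @conv_bound u (fun k => weight k ^+ j) (2 ^+ j) _ u2 (exprn_ge0 _ _) V0
  (fun k => congr1 (fun x => x ^+ j) (weightN k)) (weightXD j) s2.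
set K := 2 * 2 ^+ j * (2 * M) in cb.
have [M' sM'] := @sum_bounded_weight R.
exists ((6 * K) ^+ 2 * M').
apply: (sum_bounded_le (sum_boundedZ (sqr_ge0 _) sM')) => k.
(* hence amp^2 weight^(2 j + 2) <= (6 K)^2 weight^(-14), which is summable *)
have HV : amp u k * weight k ^+ (8 + j) <= 6 * K.
  have [hA hB] := cb (ler0n _ _) k.
  have gA := elliptic_gain k eA; have gB := elliptic_gain k eB.
  rewrite exprD mulrA /amp mulrDl mulrDl.
  have := ler_wpM2r (V0 k) gA; have := ler_wpM2r (V0 k) gB.
  move: hA hB; rewrite -!(mulrA 3).
  by set a := _ * _ * _; set b := `|cos_coef _ _| * _; set c := _ * _ * _; set d :=
    `|sin_coef _ _| * _; lra.
have Vp := @weight_gt0 R k.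
rewrite ler_pdivlMr ?exprn_gt0//.
rewrite (_ : _ * _ * _ = (amp u k * weight k ^+ (8 + j)) ^+ 2); last first.
  by rewrite exprMn -!exprM -mulrA -exprD; congr (_ * _ ^+ _); lia.
have HV0 : 0 <= amp u k * weight k ^+ (8 + j) by rewrite mulr_ge0 ?amp_ge0 ?exprn_ge0 ?weight_ge0.
by rewrite lerXn2r// nnegrE// (le_trans HV0).
Qed.

(** Rapid decrease: faster than any power of [weight], equivalently faster than
    any power of the frequency. *)
Definition rapid (a : int * int -> R) := forall j, exists C, forall k, `|a k| * weight k ^+ j <= C.

Lemma rapid_coef u : L2 u -> elliptic (cos_coef u) (cos_coef (sq u)) ->
  elliptic (sin_coef u) (sin_coef (sq u)) ->
  rapid (cos_coef u) /\ rapid (sin_coef u).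
Proof.
move=> u2 eA eB.
have h j : exists C, forall k, amp u k * weight k ^+ j <= C.
  have [M sM] := bootstrap u2 eA eB j; exists (1 + M) => k.
  have := sum_bounded_pt k sM; rewrite -exprMn.
  have : 0 <= amp u k * weight k ^+ j by rewrite mulr_ge0 ?amp_ge0 ?exprn_ge0 ?weight_ge0.
  by set x := amp u k * _; nra.
have Vj k j : 0 <= weight k ^+ j :> R by rewrite exprn_ge0 ?weight_ge0.
split=> j; have [C hC] := h j; exists C => k; apply: le_trans (hC k).
  by rewrite ler_wpM2r ?cos_coef_le_amp.
by rewrite ler_wpM2r ?sin_coef_le_amp.
Qed.

End Bootstrap.

(** * Smoothness of trigonometric series with rapidly decreasing coefficients *)

Section Series.
Context {R : realType}.
Implicit Types (k l : int * int) (p q v : R * R) (a b : int * int -> R).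

(** The sum over the frequency lattice, as the limit of sums over squares. It is
    meaningful for absolutely summable families. *)
Definition box_sum a : R := lim ((fun N => \sum_(k <- box N) a k) @ \oo).

Lemma sub_box_leq N N' : (N <= N')%N -> {subset box N <= box N'}.
Proof. by move=> NN k; rewrite !mem_box => /andP[? ?]; apply/andP; split; lia. Qed.

Let cvg_ge0 a M : (forall k, 0 <= a k) -> sum_bounded a M ->
  cvg ((fun N => \sum_(k <- box N) a k) @ \oo).
Proof.
move=> a0 aM; apply: nondecreasing_is_cvgn.
  move=> N N' NN; apply: sum_subset => //; [exact: uniq_box|exact: sub_box_leq|exact: uniq_box].
by exists M => _ [N _ <-]; apply: aM; exact: uniq_box.
Qed.

Lemma box_sum_is_cvg a M : sum_bounded (fun k => `|a k|) M ->
  cvg ((fun N => \sum_(k <- box N) a k) @ \oo).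
Proof.
move=> aM.
have c1 := cvg_ge0 (fun k => normr_ge0 (a k)) aM.
(* a is the difference of the nonnegative families |a| + a and |a| *)
have a1 k : 0 <= `|a k| + a k by have := ler_norm (- a k); rewrite normrN; lra.
have c2 : cvg ((fun N => \sum_(k <- box N) (`|a k| + a k)) @ \oo).
  apply: (cvg_ge0 (M := 2 * M) a1).
  apply: sum_bounded_le (sum_boundedZ _ aM) _ => // k.
  by have := ler_norm (a k); lra.
rewrite (_ : (fun N => _) = (fun N => \sum_(k <- box N) (`|a k| + a k)) \- (fun N =>
  \sum_(k <- box N) `|a k|)).
  exact: is_cvgB.
by apply/funext => N /=; rewrite -sumrB; apply: eq_bigr => k _; rewrite addrC addKr.
Qed.

Lemma box_sum_cvg a M : sum_bounded (fun k => `|a k|) M ->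
  (fun N => \sum_(k <- box N) a k) @ \oo --> box_sum a.
Proof. by move/box_sum_is_cvg. Qed.

Lemma box_sum_lim a x : (fun N => \sum_(k <- box N) a k) @ \oo --> x -> box_sum a = x.
Proof. by move=> h; apply: cvg_lim. Qed.

Lemma box_sumD a b M M' : sum_bounded (fun k => `|a k|) M -> sum_bounded (fun k => `|b k|) M' ->
  box_sum (fun k => a k + b k) = box_sum a + box_sum b.
Proof.
move=> aM bM; apply: box_sum_lim; under eq_fun do rewrite big_split/=.
by apply: cvgD; [exact: (box_sum_cvg aM)|exact: (box_sum_cvg bM)].
Qed.

Lemma box_sumZ c a M : sum_bounded (fun k => `|a k|) M ->
  box_sum (fun k => c * a k) = c * box_sum a.
Proof.
move=> aM; apply: box_sum_lim; under eq_fun do rewrite -mulr_sumr.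
by apply: cvgM; [exact: cvg_cst|exact: (box_sum_cvg aM)].
Qed.

Lemma box_sum_bnd a b M : (forall k, `|a k| <= b k) -> sum_bounded b M -> `|box_sum a| <= M.
Proof.
move=> ab bM; have aM : sum_bounded (fun k => `|a k|) M by exact: sum_bounded_le bM ab.
have cv : (fun N => `|\sum_(k <- box N) a k|) @ \oo --> `|box_sum a|.
  exact: (cvg_norm (box_sum_cvg aM)).
rewrite -(cvg_lim _ cv)//; apply: limr_le; first by apply/cvg_ex; eexists; exact: cv.
apply: nearW => N; apply: (le_trans (ler_norm_sum _ _ _)).
by apply: aM; exact: uniq_box.
Qed.

Lemma rapid_dom a b : rapid b -> (forall k, `|a k| <= `|b k|) -> rapid a.
Proof.
move=> rb ab j; have [C hC] := rb j; exists C => k; apply: le_trans (hC k).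
by rewrite ler_wpM2r// exprn_ge0 ?weight_ge0.
Qed.

Lemma rapidM c n b : rapid b -> (forall k, `|c k| <= n * weight k ^+ 8) ->
  rapid (fun k => c k * b k).
Proof.
move=> rb cn j; have [C hC] := rb (8 + j)%N; exists (`|n| * C) => k.
have Vj m : 0 <= weight k ^+ m :> R by rewrite exprn_ge0 ?weight_ge0.
apply: (@le_trans _ _ (`|n| * (`|b k| * weight k ^+ (8 + j)))); last by rewrite ler_wpM2l.
rewrite normrM exprD.
rewrite (_ : `|n| * _ = `|n| * weight k ^+ 8 * `|b k| * weight k ^+ j); last by ring.
by rewrite ler_wpM2r// ler_wpM2r// (le_trans (cn k))// ler_wpM2r// ler_norm.
Qed.

Lemma norm1_le_weight k : `|k.1%:~R : R| <= weight k ^+ 8.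
Proof.
rewrite weight_expr8 /parabolic -(real_normK (num_real (k.1%:~R : R))).
have := normr_ge0 (k.2%:~R : R); have := sqr_ge0 (`|k.1%:~R : R| - 1).
by nra.
Qed.

Lemma norm2_le_weight k : `|k.2%:~R : R| <= weight k ^+ 8.
Proof. by rewrite weight_expr8 /parabolic; have := sqr_ge0 (k.1%:~R : R); lra. Qed.

Lemma rapid_sum_bounded a : rapid a -> exists M, sum_bounded (fun k => `|a k|) M.
Proof.
move=> ra; have [C hC] := ra 14%N; have [M sM] := @sum_bounded_weight R.
have C0 : 0 <= C.
  by apply: le_trans (hC 0); rewrite mulr_ge0// exprn_ge0 ?weight_ge0.
exists (C * M); apply: (sum_bounded_le (sum_boundedZ C0 sM)) => k.
by rewrite ler_pdivlMr ?exprn_gt0 ?weight_gt0.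
Qed.

(** The derivatives of the phase [theta k] in the two coordinate directions. *)
Definition dirx k : R := 2 * pi * k.1%:~R.
Definition diry k : R := 2 * pi * k.2%:~R.

Lemma rapid_dirx b : rapid b -> rapid (fun k => dirx k * b k).
Proof.
move=> rb; apply: (rapidM (n := 2 * pi)) => // k; rewrite /dirx normrM.
by rewrite ger0_norm ?mulr_ge0 ?pi_ge0// ler_wpM2l ?mulr_ge0 ?pi_ge0 ?norm1_le_weight.
Qed.

Lemma rapid_diry b : rapid b -> rapid (fun k => diry k * b k).
Proof.
move=> rb; apply: (rapidM (n := 2 * pi)) => // k; rewrite /diry normrM.
by rewrite ger0_norm ?mulr_ge0 ?pi_ge0// ler_wpM2l ?mulr_ge0 ?pi_ge0 ?norm2_le_weight.
Qed.

Lemma rapidN b : rapid b -> rapid (fun k => - b k).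
Proof. by move=> rb; apply: (rapid_dom rb) => k; rewrite normrN. Qed.

(** The trigonometric series with cosine coefficients [a] and sine coefficients
    [b]. *)
Definition trig_series a b p : R := box_sum (fun k => a k * cosk k p + b k * sink k p).

Lemma trig_series_term a b k p : `|a k * cosk k p + b k * sink k p| <= `|a k| + `|b k|.
Proof.
apply: (le_trans (ler_normD _ _)); rewrite !normrM.
by apply: lerD; rewrite ler_piMr// ?cosk_le1 ?sink_le1.
Qed.

Lemma trig_series_sum_bounded a b p : rapid a -> rapid b ->
  exists M, sum_bounded (fun k => `|a k * cosk k p + b k * sink k p|) M.
Proof.
move=> ra rb; have [M sM] := rapid_sum_bounded ra; have [M' sM'] := rapid_sum_bounded rb.
exists (M + M') => s us; apply: le_trans (lerD (sM s us) (sM' s us)).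
by rewrite -big_split/=; apply: ler_sum => k _; exact: trig_series_term.
Qed.

Lemma mvt_cos (x t : R) : 0 <= t ->
  exists2 s, 0 <= s <= t & cos (x + t) - cos x = - sin (x + s) * t.
Proof.
move=> t0; have xt : x <= x + t by rewrite lerDl.
have [c] := MVT_segment xt (fun y _ => is_derive_cos y)
  (continuous_subspaceT (@continuous_cos R)).
rewrite in_itv /= => /andP[c1 c2] ->; exists (c - x).
  by rewrite subr_ge0 c1 lerBlDl.
by rewrite (addrC x t) addrK (addrC x) subrK.
Qed.

Lemma cos_lip (x y : R) : `|cos x - cos y| <= `|x - y|.
Proof.
wlog xy : x y / y <= x.
  move=> h; case/orP: (le_total y x) => [yx|xy]; first exact: h.
  by rewrite distrC (distrC x); exact: h.
have xy0 : 0 <= x - y by rewrite subr_ge0.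
have [s _] := mvt_cos y xy0.
rewrite (addrC y) subrK => ->; rewrite normrM normrN ler_piMl//.
exact: sin_max.
Qed.

Lemma sin_lip (x y : R) : `|sin x - sin y| <= `|x - y|.
Proof.
rewrite -!cosBpihalf (le_trans (cos_lip _ _))//.
by rewrite (_ : x - _ - _ = x - y)//; ring.
Qed.

(** First order Taylor expansion with a remainder uniform in [x]. *)
Lemma cos_taylor (x t : R) : `|cos (x + t) - cos x + t * sin x| <= t ^+ 2.
Proof.
wlog t0 : x t / 0 <= t.
  move=> h; case: (lerP 0 t) => [/h//|t0].
  have := h (- x) (- t); rewrite oppr_ge0 => /(_ (ltW t0)).
  by rewrite -opprD !cosN sinN mulrNN sqrrN.
have [s /andP[s0 st] ->] := mvt_cos x t0.
have -> : - sin (x + s) * t + t * sin x = t * (sin x - sin (x + s)) by ring.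
rewrite normrM ger0_norm// expr2 ler_wpM2l//.
apply: (le_trans (sin_lip _ _)); rewrite (_ : x - (x + s) = - s); last by ring.
by rewrite normrN ger0_norm.
Qed.

Lemma sin_taylor (x t : R) : `|sin (x + t) - sin x - t * cos x| <= t ^+ 2.
Proof.
have := cos_taylor (x - pi / 2) t.
have -> : x - pi / 2 + t = x + t - pi / 2 by ring.
by rewrite (cosBpihalf (x + t)) (cosBpihalf x) sinBpihalf mulrN.
Qed.

(** A uniform quadratic bound on the remainder gives a directional derivative. *)
Lemma is_derive_bnd (f : R * R -> R) p v D K :
  (forall h : R, `|f (h *: v + p) - f p - h * D| <= K * h ^+ 2) -> is_derive p v f D.
Proof.
move=> fK.
have K0 : 0 <= K.
  by apply: le_trans (normr_ge0 _) (le_trans (fK 1) _); rewrite expr1n mulr1.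
have cv : (fun h : R => h^-1 *: ((f \o shift p) (h *: v) - f p)) @ 0^' --> D.
  apply/cvgrPdist_lt => e e0.
  have K1 : 0 < K + 1 by rewrite ltr_wpDl.
  have d0 : 0 < e / (K + 1) by rewrite divr_gt0.
  near=> h.
  have h0 : h != 0 by near: h; exact: nbhs_dnbhs_neq.
  have hd : `|h| < e / (K + 1).
    near: h; apply: nbhs_dnbhs.
    have := @nbhs0_lt R R _ d0.
    by apply: filterS => h.
  rewrite distrC.
  have hp : 0 < `|h| by rewrite normr_gt0.
  rewrite -(ltr_pM2l hp) -normrM mulrBr.
  rewrite -[_ *: _]/(h^-1 * _) mulrA divff// mul1r /=.
  apply: (le_lt_trans (fK h)).
  rewrite -(real_normK (num_real h)) expr2 mulrCA ltr_pM2l//.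
  move: hd; rewrite ltr_pdivlMr// mulrC; apply: le_lt_trans.
  by rewrite ler_wpM2r// lerDl.
split; first by apply/cvg_ex; exists D.
exact: cvg_lim.
Unshelve. all: by end_near.
Qed.

(** Term by term differentiation in a direction [v] along which every phase is
    affine, with slope [c k] for the frequency [k]. No uniform convergence argument
    is needed: the quadratic remainders are summed. *)
Lemma is_derive_trig_series a b (c : int * int -> R) v p : rapid a -> rapid b ->
  (forall e, rapid e -> rapid (fun k => c k * e k)) ->
  (forall k q (h : R), theta k (h *: v + q) = theta k q + c k * h) ->
  is_derive p v (trig_series a b) (trig_series (fun k => c k * b k) (fun k => - (c k * a k)) p).
Proof.
move=> ra rb rc hc.
have rca := rc _ ra; have rcb := rc _ rb; have rcca := rc _ rca; have rccb := rc _ rcb.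
have [K sK] := rapid_sum_bounded rcca; have [K' sK'] := rapid_sum_bounded rccb.
apply: (@is_derive_bnd _ _ _ _ (K + K')) => h.
have [M1 s1] := trig_series_sum_bounded (h *: v + p) ra rb; have [M2 s2] :=
  trig_series_sum_bounded p ra rb.
have [M3 s3] := trig_series_sum_bounded p rcb (rapidN rca).
rewrite {1 2}/trig_series -mulN1r -(box_sumZ _ s2).
have s2' := sum_boundedZ (normr_ge0 (-1)) s2.
have {}s2' : sum_bounded (fun k => `|-1 * (a k * cosk k p + b k * sink k p)|) (`|-1| * M2).
  by apply: sum_bounded_le s2' _ => k; rewrite normrM.
rewrite -(box_sumD s1 s2') /trig_series -mulNr -(box_sumZ _ s3).
have s3' : sum_bounded (fun k => `|- h * (c k * b k * cosk k p +
  - (c k * a k) * sink k p)|) (`|- h| * M3).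
  by apply: sum_bounded_le (sum_boundedZ (normr_ge0 (- h)) s3) _ => k; rewrite normrM.
have s12 : sum_bounded (fun k => `|a k * cosk k (h *: v + p) + b k * sink k (h *: v + p) +
   -1 * (a k * cosk k p + b k * sink k p)|) (M1 + `|-1| * M2).
  move=> s us; apply: le_trans (lerD (s1 s us) (s2' s us)).
  by rewrite -big_split/=; apply: ler_sum => k _; exact: ler_normD.
rewrite -(box_sumD s12 s3').
apply: (@box_sum_bnd _ (fun k => (`|c k * (c k * a k)| + `|c k * (c k * b k)|) * h ^+ 2));
  last first.
  move=> s us; rewrite -mulr_suml ler_wpM2r ?sqr_ge0// big_split/=.
  by apply: lerD; [exact: sK|exact: sK'].
move=> k; rewrite /cosk /sink !hc.
have := cos_taylor (theta k p) (c k * h); have := sin_taylor (theta k p) (c k * h).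
set x := theta k p; set t := c k * h => hs hcs.
rewrite (_ : a k * _ + b k * _ + _ + _ = a k * (cos (x + t) - cos x + t * sin x) +
   b k * (sin (x + t) - sin x - t * cos x)); last by rewrite /t; ring.
apply: (le_trans (ler_normD _ _)); rewrite !normrM mulrDl.
have E y : `|c k| * (`|c k| * `|y|) * h ^+ 2 = `|y| * t ^+ 2.
  by rewrite /t exprMn -(real_normK (num_real (c k))); ring.
by rewrite !E; apply: lerD; rewrite ler_wpM2l.
Qed.

Lemma theta_ex k q (h : R) : theta k (h *: e_x + q) = theta k q + dirx k * h.
Proof.
by rewrite /theta /dirx /= [h *: 1]mulr1 [h *: 0]mulr0; ring.
Qed.

Lemma theta_ey k q (h : R) : theta k (h *: e_y + q) = theta k q + diry k * h.
Proof.
by rewrite /theta /diry /= [h *: 1]mulr1 [h *: 0]mulr0; ring.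
Qed.

Lemma theta_lip k p q : `|theta k p - theta k q| <= (`|dirx k| + `|diry k|) * `|p - q|.
Proof.
have -> : theta k p - theta k q = dirx k * (p - q).1 + diry k * (p - q).2.
  by rewrite /theta /dirx /diry /=; ring.
apply: (le_trans (ler_normD _ _)); rewrite !normrM mulrDl.
by apply: lerD; rewrite ler_wpM2l// prod_normE le_max lexx ?orbT.
Qed.

Lemma trig_series_continuous a b : rapid a -> rapid b -> continuous (trig_series a b).
Proof.
move=> ra rb.
have [K1 sK1] := rapid_sum_bounded (rapid_dirx ra); have [K2 sK2] :=
  rapid_sum_bounded (rapid_diry ra).
have [K3 sK3] := rapid_sum_bounded (rapid_dirx rb); have [K4 sK4] :=
  rapid_sum_bounded (rapid_diry rb).
pose K := K1 + K2 + (K3 + K4).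
have lip p q : `|trig_series a b p - trig_series a b q| <= K * `|p - q|.
  have [M1 s1] := trig_series_sum_bounded p ra rb; have [M2 s2] := trig_series_sum_bounded q ra rb.
  rewrite /trig_series -mulN1r -(box_sumZ _ s2).
  have s2' : sum_bounded (fun k => `|-1 * (a k * cosk k q + b k * sink k q)|) (`|-1| * M2).
    by apply: sum_bounded_le (sum_boundedZ (normr_ge0 (-1)) s2) _ => k; rewrite normrM.
  rewrite -(box_sumD s1 s2').
  apply: (@box_sum_bnd _ (fun k => (`|dirx k * a k| + `|diry k * a k| + (`|dirx k * b k| +
    `|diry k * b k|)) * `|p - q|)); last first.
    move=> s us; rewrite -mulr_suml ler_wpM2r// !big_split/=.
    by apply: lerD; apply: lerD; [exact: sK1|exact: sK2|exact: sK3|exact: sK4].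
  move=> k; have := theta_lip k p q.
  have := cos_lip (theta k p) (theta k q); have := sin_lip (theta k p) (theta k q).
  rewrite -/(cosk k p) -/(cosk k q) -/(sink k p) -/(sink k q).
  move=> hs hc ht.
  rewrite (_ : a k * _ + b k * _ + _ = a k * (cosk k p - cosk k q) +
    b k * (sink k p - sink k q)); last by ring.
  apply: (le_trans (ler_normD _ _)).
  rewrite (normrM (a k)) (normrM (b k)) !(normrM (dirx k)) !(normrM (diry k)) -!mulrDl.
  rewrite (_ : _ * `|p - q| = `|a k| * ((`|dirx k| + `|diry k|) * `|p - q|) + `|b k|
    * ((`|dirx k| + `|diry k|) * `|p - q|)); last by ring.
  apply: lerD; rewrite ler_wpM2l//.
    exact: le_trans ht.
  exact: le_trans ht.
move=> p; apply/cvgrPdist_lt => e e0.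
have K1' : 0 < `|K| + 1 by rewrite ltr_wpDl.
have d0 : 0 < e / (`|K| + 1) by rewrite divr_gt0.
near=> q.
apply: (le_lt_trans (lip p q)).
have hq : `|p - q| < e / (`|K| + 1).
  by near: q; exact: cvgr_dist_lt.
move: hq; rewrite ltr_pdivlMr// mulrC; apply: le_lt_trans.
by rewrite ler_wpM2r// ler_wpDr// ler_norm.
Unshelve. all: by end_near.
Qed.

Lemma trig_series_Ck n a b : rapid a -> rapid b -> Ck n (trig_series a b).
Proof.
elim: n a b => [|n ih] a b ra rb; first by split=> //; exact: trig_series_continuous.
have dx p := is_derive_trig_series p ra rb rapid_dirx theta_ex.
have dy p := is_derive_trig_series p ra rb rapid_diry theta_ey.
split; first exact: trig_series_continuous.
split.
- by move=> p; split; [have [] := dx p|have [] := dy p].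
- rewrite (_ : (fun p => _) = trig_series (fun k => dirx k * b k) (fun k => - (dirx k * a k))).
    by apply: ih; [exact: rapid_dirx|exact/rapidN/rapid_dirx].
  by apply/funext => p; have [] := dx p.
- rewrite (_ : (fun p => _) = trig_series (fun k => diry k * b k) (fun k => - (diry k * a k))).
    by apply: ih; [exact: rapid_diry|exact/rapidN/rapid_diry].
  by apply/funext => p; have [] := dy p.
Qed.

Lemma trig_series_smooth a b : rapid a -> rapid b -> smooth (trig_series a b).
Proof. by move=> ra rb n; exact: trig_series_Ck. Qed.

Lemma cosk_per k (x y : R) : cosk k (x + 1, y) = cosk k (x, y) /\ cosk k (x, y + 1) = cosk k (x, y).
Proof.
have h n z : cos (z + 2 * pi * n%:~R) = cos z :> R.
  by rewrite cosD cos_2piz sin_2piz mulr1 mulr0 subr0.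
by rewrite /cosk; split; rewrite -[RHS](h (k.1)) + rewrite -[RHS](h k.2); congr cos;
  rewrite /theta/=; ring.
Qed.

Lemma sink_per k (x y : R) : sink k (x + 1, y) = sink k (x, y) /\ sink k (x, y + 1) = sink k (x, y).
Proof.
have h n z : sin (z + 2 * pi * n%:~R) = sin z :> R.
  by rewrite sinD cos_2piz sin_2piz mulr1 mulr0 addr0.
by rewrite /sink; split; rewrite -[RHS](h (k.1)) + rewrite -[RHS](h k.2); congr sin;
  rewrite /theta/=; ring.
Qed.

Lemma trig_series_periodic a b : periodic2 (trig_series a b).
Proof.
move=> x y; split; congr box_sum; apply/funext => k.
  by rewrite (cosk_per k x y).1 (sink_per k x y).1.
by rewrite (cosk_per k x y).2 (sink_per k x y).2.
Qed.

(** The family supported at the frequency [l] with value [c]; it presents a single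
    mode as a trigonometric series, so that the smoothness of characters is a case
    of that of trigonometric series. *)
Definition single l (c : R) k : R := c * (k == l)%:R.

Lemma rapid_single l c : rapid (single l c).
Proof.
move=> j; exists (`|c| * weight l ^+ j) => k; rewrite /single.
have [->|_] := eqVneq k l; first by rewrite mulr1.
by rewrite mulr0 normr0 mul0r mulr_ge0// exprn_ge0 ?weight_ge0.
Qed.

Lemma trig_series_single l c d p : trig_series (single l c) (single l d) p = c * cosk l p +
  d * sink l p.
Proof.
apply: box_sum_lim; apply: (@cvg_near_cst).
exists (maxn `|l.1| `|l.2|) => // N /=; rewrite geq_max => lN.
rewrite -(@sum_indicator R _ (box N) (fun k => c * cosk k p + d * sink k p) l) ?uniq_box ?mem_box//.
by apply: eq_bigr => k _; rewrite /single; ring.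
Qed.

End Series.

(** * From the equation to its Fourier coefficients, and back *)

Section Modes.
Context {R : realType}.
Implicit Types (k l : int * int) (p : R * R) (z : R[i]) (f u : R * R -> R).

Lemma mulcE (a b c d : R) : (a +i* b) * (c +i* d) = (a * c - b * d) +i* (a * d + b * c) :> R[i].
Proof. by []. Qed.

(** The character of frequency [k] multiplied by the scalar [z]. These test
    functions are stable under differentiation. *)
Definition mode z k p : R[i] := z * echar k.1 k.2 p.

Lemma mode_Re z k : (fun p => complex.Re (mode z k p)) =
  trig_series (single k (complex.Re z)) (single k (- complex.Im z)).
Proof.
by apply/funext => p; rewrite trig_series_single /mode; case: z => a b /=; rewrite mulNr.
Qed.

Lemma mode_Im z k : (fun p => complex.Im (mode z k p)) =
  trig_series (single k (complex.Im z)) (single k (complex.Re z)).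
Proof.
by apply/funext => p; rewrite trig_series_single /mode; case: z => a b /=; rewrite addrC.
Qed.

Lemma mode_test z k : test_fun (mode z k).
Proof.
split.
- move=> x y; rewrite /mode; have [c1 c2] := @cosk_per R k x y; have [s1 s2] := @sink_per R k x y.
  by split; congr (_ * Complex _ _).
- by rewrite mode_Re; apply: trig_series_smooth; exact: rapid_single.
- by rewrite mode_Im; apply: trig_series_smooth; exact: rapid_single.
Qed.

Lemma echar_mode n m : echar n m = mode 1 (n, m).
Proof. by apply/funext => p; rewrite /mode mul1r. Qed.

Lemma cderive_mode (c : int * int -> R) v z k :
  (forall e, rapid e -> rapid (fun k => c k * e k)) ->
  (forall k q (h : R), theta k (h *: v + q) = theta k q + c k * h) ->
  cderive v (mode z k) = mode ((0 +i* c k) * z) k.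
Proof.
move=> rc hc; apply/funext => p; rewrite /cderive mode_Re mode_Im.
have rs := @rapid_single R.
have [_ ->] := is_derive_trig_series p (rs k (complex.Re z)) (rs k (- complex.Im z)) rc hc.
have [_ ->] := is_derive_trig_series p (rs k (complex.Im z)) (rs k (complex.Re z)) rc hc.
have E (x y : R) : trig_series (fun l => c l * single k x l) (fun l => - (c l * single k y l)) p =
    c k * x * cosk k p - c k * y * sink k p.
  have -> : (fun l => c l * single k x l) = single k (c k * x).
    by apply/funext => l; rewrite /single; have [->|] := eqVneq l k; rewrite ?mulr0 ?mulr1.
  have -> : (fun l => - (c l * single k y l)) = single k (- (c k * y)).
    by apply/funext => l; rewrite /single; have [->|] := eqVneq l k; rewrite ?mulr0 ?mulr1 ?oppr0.
  by rewrite trig_series_single mulNr.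
rewrite !E /mode; case: z => a b /=.
rewrite -/(cosk _ _) -/(sink _ _) !mulcE.
by congr (_ +i* _); rewrite /cosk /sink /theta /=; ring.
Qed.

Lemma cderive_mode_x z k : cderive e_x (mode z k) = mode ((0 +i* dirx k) * z) k.
Proof. by apply: cderive_mode; [exact: rapid_dirx|exact: theta_ex]. Qed.

Lemma cderive_mode_y z k : cderive e_y (mode z k) = mode ((0 +i* diry k) * z) k.
Proof. by apply: cderive_mode; [exact: rapid_diry|exact: theta_ey]. Qed.

(** The pairing of a real integrable function with a mode. *)
Lemma tint_mode f z k : L1 f ->
  tint (fun p => (f p)%:C * mode z k p) = z * (cos_coef f k +i* sin_coef f k).
Proof.
move=> f1.
have fc : L1 (fun p => f p * cosk k p) by apply: (L1_bndM f1 (meas2_cosk k) (fun p _ =>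
  cosk_le1 k p)).
have fs : L1 (fun p => f p * sink k p) by apply: (L1_bndM f1 (meas2_sink k) (fun p _ =>
  sink_le1 k p)).
case: z => a b; rewrite /tint mulcE /cos_coef /sin_coef; congr (_ +i* _).
- rewrite -!tmeanZ// -tmeanB; [|exact: L1Z|exact: L1Z].
  apply: eq_tmean => p _; rewrite /mode /echar mulcE /=.
  by rewrite -/(cosk k p) -/(sink k p) mul0r subr0 mulrBr; ring.
- rewrite -!tmeanZ// -tmeanD; [|exact: L1Z|exact: L1Z].
  apply: eq_tmean => p _; rewrite /mode /echar mulcE /=.
  by rewrite -/(cosk k p) -/(sink k p) mul0r addr0 mulrDr; ring.
Qed.

Lemma imaginary_inv (r : R) : r != 0 -> (0 +i* r)^-1 = 0 +i* (- r^-1) :> R[i].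
Proof.
move=> r0; have n0 : (0 +i* r) != 0 :> R[i] by rewrite eq_complex /= negb_and r0 orbT.
apply: (mulfI n0); rewrite divff// mulcE.
by rewrite !mul0r mulr0 sub0r mulrN mulfV// opprK addr0.
Qed.

(** The equation tested on a character. For both values of [d] the sign in front of
    the dispersive term makes the symbol x^(d + 1) + y^2 positive, where
    x = [dirx k] and y = [diry k]. *)
Lemma weak_solution_coef d u k : L2 u -> weak_solution d u -> d = 3%N \/ d = 5%N -> k.1 != 0 ->
  (dirx k ^+ d.+1 + diry k ^+ 2) * cos_coef u k = dirx k ^+ 2 * cos_coef (sq u) k /\
  (dirx k ^+ d.+1 + diry k ^+ 2) * sin_coef u k = dirx k ^+ 2 * sin_coef (sq u) k.
Proof.
move=> u2 [S [_ hS] heq] hd k0.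
have := heq _ (mode_test 1 k).
have u1 := L2_L1 u2; have s1 : L1 (sq u) by exact: L2_sqr.
(* the inverse x-derivative enters only through its Fourier coefficients *)
have {}hS : S (mode 1 k) = ((0 +i* (- dirx k))^-1) * ((0 +i* diry k) * ((0 +i* diry k) *
  (cos_coef u k +i* sin_coef u k))).
  have := hS (- k.1) (- k.2); rewrite /dcoef !opprK oppr_eq0 (negPf k0).
  rewrite echar_mode -surjective_pairing => ->.
  rewrite /distr_derive !cderive_mode_y opprK /distr_of tint_mode// mulr1 !mulrA.
  by rewrite mulrNz mulrN.
have n0 : dirx k != 0 :> R.
  by rewrite /dirx mulf_neq0 ?intr_eq0// mulf_neq0 ?pnatr_eq0// gt_eqF ?pi_gt0.
have U2E z : distr_of (fun p => (u p ^+ 2)%:C) (mode z k) =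
  z * (cos_coef (sq u) k +i* sin_coef (sq u) k).
  exact: (tint_mode z k s1).
have UE z : distr_of (fun p => (u p)%:C) (mode z k) = z * (cos_coef u k +i* sin_coef u k).
  exact: tint_mode.
rewrite {}hS imaginary_inv ?oppr_eq0// invrN opprK.
have E4 : (-1) ^+ (3.+1)./2 = 1 :> R[i] by rewrite /= sqrrN expr1n.
have E5 : (-1) ^+ (5.+1)./2 = -1 :> R[i] by rewrite /= exprS sqrrN expr1n mulr1.
set A := cos_coef u k in UE *; set B := sin_coef u k in UE *.
set A2 := cos_coef (sq u) k in U2E *; set B2 := sin_coef (sq u) k in U2E *.
set x := dirx k in n0 *; set y := diry k.
case: hd => ->; rewrite ?E4 ?E5 /= /distr_derive !cderive_mode_x UE U2E mulr1 !mulcE -?/x.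
(* The imaginary part of the equation, multiplied by x, is the relation for the cosine
   coefficients; its real part, multiplied by - x, is that for the sine ones. *)
all: clearbody A B A2 B2 x y; move=> /eqP; rewrite eq_complex /= => /andP[/eqP e1 /eqP e2].
all: split; apply: subr0_eq; [rewrite -(mulr0 x) -e2|rewrite -(mulr0 (- x)) -e1]; by field.
Qed.

Lemma sqr4E (x : R) : x ^+ 4 = (x ^+ 2) ^+ 2. Proof. by rewrite -exprM. Qed.

(** The powers of 2 pi >= 1 are dropped, and for [d = 5] n^6 >= n^4 is used. The
    vanishing for n = 0 is the condition on the x-means of [u]. *)
Lemma weak_solution_elliptic d u : L2 u -> weak_solution d u -> d = 3%N \/ d = 5%N ->
  (forall m : int, fcoef (fun p => (u p)%:C) 0 m = 0) ->
  elliptic (cos_coef u) (cos_coef (sq u)) /\ elliptic (sin_coef u) (sin_coef (sq u)).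
Proof.
move=> u2 hw hd h0.
have zero k : k.1 = 0 -> cos_coef u k = 0 /\ sin_coef u k = 0.
  move=> k1; have := h0 (- k.2); rewrite /fcoef oppr0 opprK -k1 echar_mode -surjective_pairing.
  by rewrite (tint_mode 1 k (L2_L1 u2)) mul1r => -[].
have key (a b : int * int -> R) k : k.1 != 0 ->
  (dirx k ^+ d.+1 + diry k ^+ 2) * a k = dirx k ^+ 2 * b k ->
  (k.1%:~R ^+ 4 + k.2%:~R ^+ 2) * `|a k| <= k.1%:~R ^+ 2 * `|b k|.
  move=> k0 e.
  have n1 : 1 <= `|k.1%:~R : R| by rewrite -intr_norm ler1z -gtz0_ge1 normr_gt0.
  have : (dirx k ^+ d.+1 + diry k ^+ 2) * `|a k| <= dirx k ^+ 2 * `|b k|.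
    rewrite -[dirx k ^+ 2 in leRHS]ger0_norm ?sqr_ge0// -normrM -e normrM.
    by rewrite ler_wpM2r// ler_norm.
  have pi2 : 1 <= 2 * pi :> R by have := pi_ge2 R; lra.
  rewrite /dirx /diry; move: (2 * pi) pi2 => c c1.
  have c0 : 0 < c by apply: lt_le_trans c1.
  rewrite !exprMn -(mulrA (c ^+ 2) _ `|b k|) => h.
  rewrite -(ler_pM2l (exprn_gt0 2 c0)); apply: le_trans h.
  rewrite mulrA ler_wpM2r// mulrDr lerD2r.
  have n20 : 0 <= k.1%:~R ^+ 2 :> R by exact: sqr_ge0.
  have n21 : 1 <= k.1%:~R ^+ 2 :> R.
    by rewrite -(real_normK (num_real (k.1%:~R : R))) exprn_ege1.
  case: hd => ->.
    by rewrite ler_wpM2r ?sqr4E ?sqr_ge0// -sqr4E ler_weXn2l.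
  have -> : c ^+ 6 * k.1%:~R ^+ 6 = c ^+ 6 * k.1%:~R ^+ 2 * (k.1%:~R ^+ 4) by rewrite -mulrA -exprD.
  rewrite ler_wpM2r ?sqr4E ?sqr_ge0//.
  apply: (@le_trans _ _ (c ^+ 6)); first by rewrite ler_weXn2l.
  by rewrite ler_peMr// exprn_ge0// ltW.
by split=> k; (split; first by move=> /zero[]);
  have [k1|k1] := eqVneq k.1 0;
  (try by (have [a0 b0] := zero _ k1; rewrite ?a0 ?b0 normr0 mulr0 mulr_ge0// sqr_ge0));
  apply: key => //; have [] := weak_solution_coef u2 hw hd k1.
Qed.

(** A function with rapidly decreasing Fourier coefficients is almost everywhere
    the sum of its Fourier series. *)
Lemma ae_eq_trig_series u : L2 u -> rapid (cos_coef u) -> rapid (sin_coef u) ->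
  {ae @leb2 R, forall p, cell p -> u p = trig_series (cos_coef u) (sin_coef u) p}.
Proof.
move=> u2 ra rb; set g := trig_series _ _.
have [K sK] := rapid_sum_bounded ra; have [K' sK'] := rapid_sum_bounded rb.
have sKK : sum_bounded (fun k => `|cos_coef u k| + `|sin_coef u k|) (K + K').
  by move=> s us; rewrite big_split/=; apply: lerD; [exact: sK|exact: sK'].
have gK p : `|g p| <= K + K' by apply: (box_sum_bnd _ sKK) => k; exact: trig_series_term.
have PK N p : `|fourier_sum u N p| <= K + K'.
  apply: (le_trans (ler_norm_sum _ _ _)); apply: le_trans (sKK _ (uniq_box N)).
  by apply: ler_sum => k _; exact: trig_series_term.
have Pg p : fourier_sum u ^~ p @ \oo --> g p.
  by have [M sM] := trig_series_sum_bounded p ra rb; exact: box_sum_cvg sM.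
have mP N : meas2 (fourier_sum u N) by have [] := trigpoly_L2 (trigpoly_fourier_sum u N).
have mg : meas2 g.
  by apply: (measurable_fun_cvg (h := fourier_sum u)) => // p _; exact: Pg.
have g2 : L2 g by apply: (@L2_bnd _ (K + K')) => // p _; exact: gK.
have cg : (fun N => tmean (fun p => (fourier_sum u N p - g p) ^+ 2)) @ \oo --> (0 : R).
  apply: (@L2_dominated _ _ _ (fun=> K + K')) => //.
  - exact: trigpoly_L2 (trigpoly_cst _).
  - by apply: aeW => p _; exact: Pg.
have I0 : tmean (fun p => (u p - g p) ^+ 2) = 0.
  apply/eqP; rewrite eq_le tmean_ge0 ?andbT; last by move=> p; exact: sqr_ge0.
  have c2 : (fun N => 2 * tmean (fun p => (u p - fourier_sum u N p) ^+ 2) + 2 * tmean (fun p =>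
    (fourier_sum u N p - g p) ^+ 2))
      @ \oo --> (0 : R).
    rewrite -[X in _ --> X](_ : 2 * 0 + 2 * 0 = 0); last by rewrite mulr0 addr0.
    by apply: cvgD; apply: cvgM; (try exact: cvg_cst); [exact: fourier_sum_cvg|exact: cg].
  rewrite -(cvg_lim _ c2)//; apply: limr_ge; first by apply/cvg_ex; eexists; exact: c2.
  apply: nearW => N; have P2 := trigpoly_L2 (trigpoly_fourier_sum u N).
  have := tmean_sqrD (L2B u2 P2) (L2B P2 g2).
  by under [X in tmean X <= _ -> _]eq_fun do rewrite addrA subrK.
have [_ iug] := L2_sqr (L2B u2 g2).
have mug : measurable_fun (@cell R : set (measurableTypeR R * measurableTypeR R))
  (fun p => ((u p - g p) ^+ 2)%:E) by case/integrableP: iug.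
have int0 : (\int[@leb2 R]_(p in @cell R) `|((u p - g p) ^+ 2)%:E| = 0)%E.
  under eq_integral do rewrite gee0_abs ?lee_fin ?sqr_ge0//.
  have := integrable_fin_num (@measurable_cell R) iug.
  by move=> /fineK <-; move: I0; rewrite /tmean /Rintegral => ->.
have [N [mN N0 sub]] := (ae_eq_integral_abs _ (@measurable_cell R) mug).1 int0.
exists N; split=> //; apply: subset_trans sub; apply: subsetC => p h cp.
by have /eqP := h cp; rewrite eqe expf_eq0 /= subr_eq0 => /eqP.
Qed.

End Modes.

Theorem theorem1p9 (R : realType) (d : nat) (u : R * R -> R)
    (hd : d = 3%N \/ d = 5%N)
    (hu : L2torus u)
    (hx : forall m : int, fcoef (fun p => (u p)%:C) 0 m = 0)
    (heq : weak_solution d u) :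
  smooth_on_torus u.
Proof.
have [_ mu iu] := hu; have u2 : L2 u by [].
have [eA eB] := weak_solution_elliptic u2 heq hd hx.
have [ra rb] := rapid_coef u2 eA eB.
exists (trig_series (cos_coef u) (sin_coef u)); split.
- exact: trig_series_periodic.
- exact: trig_series_smooth.
- exact: ae_eq_trig_series.
Qed.
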